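(* Let $n\ge 1$ and $k\ge 0$ be integers with $2^k<n$, and let $d(n,k)=\nu_2\big(\big\lfloor \frac{n}{2^k}\big\rfloor\big)$. Let $f_k^n\colon \mathrm{Irr}_{2'}(\mathfrak{S}_n)\to \mathrm{Irr}_{2'}(\mathfrak{S}_{n-2^k})$ be the map sending $\chi$ to the unique odd-degree irreducible constituent of the restriction $\chi_{\mathfrak{S}_{n-2^k}}$ that appears with odd multiplicity. (1) If $k=0$, then $f^n_k$ is surjective if and only if $d(n,k)\le 2$. (2) If $k>0$, then $f^n_k$ is surjective if and only if $d(n,k)\le 1$.
   Context: $\mathfrak{S}_n$ is the symmetric group on $n$ letters and $\mathrm{Irr}_{2'}(\mathfrak{S}_n)$ is the set of its irreducible complex characters of odd degree. $\nu_2(a)$ is the exponent of the highest power of $2$ dividing the positive integer $a$. It is a known result (Isaacs, Navarro, Olsson, Tiep) that for every $\chi\in \mathrm{Irr}_{2'}(\mathfrak{S}_n)$ and every $k\ge0$ with $2^k<n$ the restriction $\chi_{\mathfrak{S}_{n-2^k}}$ has a unique odd-degree irreducible constituent appearing with odd multiplicity, so $f_k^n$ is well defined. Equivalent known description: label irreducible characters by partitions, $\chi^\lambda\leftrightarrow\lambda$, and call $\lambda$ odd if $\chi^\lambda$ has odd degree; then for an odd partition $\lambda$ of $n$ there is exactly one $2^k$-hook of $\lambda$ whose removal leaves an odd partition $\mu$ of $n-2^k$, and $f_k^n(\chi^\lambda)=\chi^\mu$. *)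

(* Defs.v *)
From HB Require Import structures.
From mathcomp Require Import all_boot all_order all_algebra all_fingroup.
From mathcomp Require Import all_field all_character.

Set Implicit Arguments.
Unset Strict Implicit.
Unset Printing Implicit Defensive.

Import Order.TTheory GRing.Theory Num.Theory.
Local Open Scope ring_scope.

Definition surjective (A B : Type) (f : A -> B) : Prop :=
  forall y : B, exists x : A, f x = y.

(* The set Irr_{2'}(G). An irreducible character 'chi_i is represented by its *)
(* index i : Iirr G; its values lie in algC, which loses nothing since every  *)
(* complex character of a finite group takes algebraic values.                *)
Definition odd_Iirr (gT : finGroupType) (G : {group gT}) : finType :=
  {i : Iirr G | ~~ (2 %| 'chi_i 1%g)%C}.

(* The copy of the symmetric group on m letters inside 'S_n: the permutations *)
(* of {0, .., n-1} that fix every point >= m.                                 *)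
Definition Sym_below (n m : nat) : {group 'S_n} :=
  [group of Sym [set i : 'I_n | (i < m)%N]].

(* An odd multiplicity is nonzero, so 'chi_j is then a constituent of the     *)
(* restriction of 'chi_i to H.                                                *)
Definition odd_mult (gT : finGroupType) (G H : {group gT})
    (i : Iirr G) (j : Iirr H) : bool :=
  ~~ (2 %| '['Res[H] 'chi_i, 'chi_j])%C.

Lemma odd_mult_exists (gT : finGroupType) (G H : {group gT}) :
  H \subset G ->
  forall i : odd_Iirr G, exists j : odd_Iirr H, odd_mult (val i) (val j).
Proof.
move=> sHG [i odd_i] /=.
have Nres : 'Res[H] 'chi_i \is a character by rewrite cfRes_char ?irr_char.
have [/existsP[j /andP[odd_j mij]]|none] := boolP [exists j : Iirr H,
    ~~ (2 %| 'chi_j 1%g)%C && odd_mult i j].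
  by exists (exist _ j odd_j).
case/negP: odd_i; rewrite -(cfResE 'chi_i sHG (group1 H)).
rewrite ['Res[H] 'chi_i]cfun_sum_cfdot sum_cfunE rpred_sum // => j _.
rewrite cfunE; move/existsPn/(_ j): none; rewrite /odd_mult negb_and !negbK.
case/orP=> dv.
  by apply: dvdC_mull => //; rewrite intr_nat ?Cnat_cfdot_char_irr.
by apply: dvdC_mulr => //; rewrite intr_nat ?Cnat_irr1.
Qed.

(* The map f_k^n. The constituent chosen here exists by the parity argument   *)
(* above; by a theorem of Isaacs, Navarro, Olsson and Tiep it is the only one *)
(* of odd degree and odd multiplicity, so the choice is no choice at all.     *)
Definition odd_restr (n k : nat) (i : odd_Iirr [set: 'S_n]) :
    odd_Iirr (Sym_below n (n - 2 ^ k)) :=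
  xchoose (odd_mult_exists (subsetT (Sym_below n (n - 2 ^ k))) i).

Definition d2 (n k : nat) : nat := logn 2 (n %/ 2 ^ k).

(* Main.v *)
(* Modulo 2 everything is governed by Frobenius' determinantal description of *)
(* the characters of symmetric groups. For a vector [nu] of N beta-numbers,   *)
(* the coefficient of x ^ nu in (power sum of the cycle type) * (Vandermonde) *)
(* is a virtual character; these are orthonormal up to the sign of the        *)
(* permutation matching two vectors (a determinantal Cauchy identity, proved  *)
(* here by induction through the energy identity of the fermionic Fock        *)
(* space), and they exhaust the irreducible characters up to sign, because    *)
(* the permutation characters are triangular with respect to them.            *)
(* Restricting from n to n - 2 ^ k letters replaces nu by all vectors         *)
(* nu - (content of a word of length 2 ^ k), and modulo 2 only the constant   *)
(* words survive, since p_1 ^ (2 ^ k) = p_(2 ^ k): so the odd multiplicities  *)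
(* are given by the removals of 2 ^ k-hooks, i.e. by sliding a bead of the    *)
(* beta-set down by 2 ^ k.                                                    *)
(* Let K be the largest power of 2 with K <= n. An odd partition of n has a   *)
(* unique K-hook, and removing it leaves an odd partition of n - K. If        *)
(* 2 ^ k <= n - K, removing K-hooks commutes with removing 2 ^ k-hooks, which *)
(* reduces everything to n - K. Otherwise the partition is a K-hook added to  *)
(* a 2 ^ k-core: it has at most two removable 2 ^ k-hooks, hence exactly one  *)
(* with odd remainder, and surjectivity is decided by explicit beta-sets.     *)

Require Import Defs.
From mathcomp Require Import all_boot all_order all_algebra all_fingroup.
From mathcomp Require Import all_field all_character.
From mathcomp Require Import finmap zify ring.

Set Implicit Arguments.
Unset Strict Implicit.
Unset Printing Implicit Defensive.

Import Order.TTheory GRing.Theory Num.Theory.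
Local Open Scope fset_scope.
Local Open Scope ring_scope.

(** * Lowering operators on integer vectors *)

(** On labels, [odd_restr] sends an odd beta-set to its unique [2 ^ k]-slide with odd remainder:
    [odd_mult_labelP] translates odd multiplicities into slides, [odd_slide_unique] gives
    uniqueness, and [surjective_odd_restrP] concludes that surjectivity is the combinatorial
    statement [slide_onto].

    Write n = r + 2^a with r < 2^a. What remains is n = r + 2^(k+d) with r < 2^k and d = d(n,k). The
    odd partitions of n are then single 2^(k+d)-hooks added to odd 2^k-cores of r, while those of n
    - 2^k are obtained from such cores by adding hooks of lengths 2^k, ..., 2^(k+d-1) in turn.

    If d = 0, any added 2^k-hook gives a preimage; if d = 1, the bead carrying the 2^k-hook is
    raised once more. If d >= 2 and k > 0, the target may have displaced beads on two runners modulo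
    2^k, whereas a slide of a single hook disturbs only one runner ([not_slide_onto_pos]). For k = 0
    there is only one runner, and the obstruction is that odd partitions of 2^d are hooks: n = 4 is
    still surjective ([slide_onto_4]), but for d >= 3 the partition (3,3,1) grows into an odd
    partition of 2^d - 1 lying in no hook ([not_slide_onto_k0]). *)

Definition ivec (N : nat) := {ffun 'I_N -> int}.

Definition spike (N : nat) (q : nat) (i : 'I_N) : ivec N :=
  [ffun j => if j == i then q%:Z else 0].

(** On coefficient functions of polynomials this is multiplication by the power sum p_q. *)
Definition down (N : nat) (M : zmodType) (q : nat) (F : ivec N -> M) (nu : ivec N) : M :=
  \sum_i F (nu - spike q i).

(* Unlike [ffunE], these keep all values at the same syntactic form, which    *)
(* [lia] needs.                                                               *)
Lemma ivecD (N : nat) (nu mu : ivec N) i : (nu + mu) i = nu i + mu i.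
Proof. by rewrite ffunE. Qed.

Lemma ivecN (N : nat) (nu : ivec N) i : (- nu) i = - nu i.
Proof. by rewrite ffunE. Qed.

Lemma spikeE (N : nat) q (i j : 'I_N) :
  spike q i j = if j == i then q%:Z else 0.
Proof. by rewrite ffunE. Qed.

Definition ivecE := (ivecD, ivecN, spikeE).

Section DownOperators.
Variable N : nat.
Implicit Types (nu mu : ivec N) (q : nat).

Lemma spikeD q1 q2 (i : 'I_N) : spike (q1 + q2) i = spike q1 i + spike q2 i.
Proof. by apply/ffunP=> j; rewrite !ffunE; case: eqP => // _; rewrite PoszD. Qed.

Lemma eq_down (M : zmodType) q (F G : ivec N -> M) : F =1 G -> down q F =1 down q G.
Proof. by move=> eqFG nu; apply: eq_bigr => i _; rewrite eqFG. Qed.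

Lemma eq_iter_down (M : zmodType) q r (F G : ivec N -> M) :
  F =1 G -> iter r (down q) F =1 iter r (down q) G.
Proof. by move=> eqFG; elim: r => //= r IHr; apply: eq_down. Qed.

Lemma iter_down_morph (M M' : zmodType) (f : M -> M') q r (F : ivec N -> M) nu :
  f 0 = 0 -> {morph f : x y / x + y} ->
  f (iter r (down q) F nu) = iter r (down q) (f \o F) nu.
Proof.
move=> f0 fD; elim: r nu => //= r IHr nu; rewrite /down (big_morph f fD f0).
by apply: eq_bigr => i _; rewrite -IHr.
Qed.

(** The terms at (i, j) and (j, i) cancel in characteristic 2; applied to [down q] twice this is the
    identity p_q^2 = p_(2q). *)
Lemma char2_sum_sym (I : finType) (M : zmodType) (F : I -> I -> M) :
  (forall x : M, x + x = 0) -> (forall i j, F i j = F j i) ->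
  \sum_i \sum_j F i j = \sum_i F i i.
Proof.
move=> M2 symF; pose r (i : I) : nat := enum_rank i.
have split3 (i j : I) : F i j = (if i == j then F i j else 0) +
    ((if (r i < r j)%N then F i j else 0) + (if (r j < r i)%N then F i j else 0)).
  rewrite /r; case: (ltngtP (enum_rank i) (enum_rank j)) => [lt|lt|/val_inj/enum_rank_inj ->].
  - by rewrite (_ : i == j = false) ?add0r ?addr0 //; apply/eqP=> eij; rewrite eij ltnn in lt.
  - by rewrite (_ : i == j = false) ?add0r ?addr0 //; apply/eqP=> eij; rewrite eij ltnn in lt.
  - by rewrite eqxx !addr0.
under eq_bigr do under eq_bigr do rewrite split3.
under eq_bigr do rewrite big_split /=.
rewrite big_split /= -[RHS]addr0; congr (_ + _).
  by apply: eq_bigr => i _; rewrite (bigD1 i) //= eqxx big1 ?addr0 // => j; rewrite eq_sym => /negPf->.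
under eq_bigr do rewrite big_split /=.
rewrite big_split /= [X in _ + X]exchange_big /=.
have -> : \sum_j \sum_i (if (r j < r i)%N then F i j else 0)
  = \sum_i \sum_j (if (r i < r j)%N then F i j else 0) by apply: eq_bigr => i _; apply: eq_bigr => j _; rewrite symF.
exact: M2.
Qed.

Lemma down_comp_same (M : zmodType) q (F : ivec N -> M) :
  (forall x : M, x + x = 0) -> down q (down q F) =1 down (q + q) F.
Proof.
move=> M2 nu; rewrite /down.
rewrite (char2_sum_sym (F := fun i j => F (nu - spike q i - spike q j))) //; last by move=> i j; rewrite addrAC.
by apply: eq_bigr => i _; rewrite spikeD opprD addrA.
Qed.

(* The Frobenius map on symmetric functions: p_1 ^ (2 ^ k) = p_(2 ^ k) modulo 2. *)
Lemma iter_down1_pow2 (M : zmodType) k (F : ivec N -> M) :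
  (forall x : M, x + x = 0) -> iter (2 ^ k) (down 1) F =1 down (2 ^ k) F.
Proof.
move=> M2; elim: k F => [|k IHk] F nu //=.
rewrite expnS mul2n -addnn iterD IHk (eq_down _ (IHk F)).
exact: down_comp_same.
Qed.

(* Antisymmetry as it reads modulo 2, with vanishing at negative entries.     *)
Definition fermionic (M : zmodType) (F : ivec N -> M) :=
  [/\ forall nu (s : {perm 'I_N}), F [ffun i => nu (s i)] = F nu,
      forall nu, ~~ injectiveb nu -> F nu = 0 &
      forall nu i, nu i < 0 -> F nu = 0].

Lemma fermionic_down (M : zmodType) q (F : ivec N -> M) :
  (forall x : M, x + x = 0) -> fermionic F -> fermionic (down q F).
Proof.
move=> M2 [Fsym Fni Fneg]; split=> [nu s|nu|nu i nui_lt0].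
- rewrite /down [RHS](reindex_inj (@perm_inj _ s)) /=; apply: eq_bigr => i _.
  rewrite -(Fsym (nu - _) s); congr F; apply/ffunP=> j; by rewrite !ffunE (inj_eq perm_inj).
- case/injectivePn=> i [j neq_ij eq_nu].
  (* Lowering either of the two equal entries gives vectors that differ by a transposition and
     cancel modulo 2; lowering any other entry keeps the repetition. *)
  rewrite /down (bigD1 i) //= (bigD1 j) /=; last by rewrite eq_sym.
  rewrite addrA big1 => [|l /andP[li lj]].
    rewrite addr0 -(Fsym (nu - spike q j) (tperm i j)).
    rewrite (_ : [ffun _ => _] = nu - spike q i) ?M2 //.
    apply/ffunP=> l; rewrite !ffunE; case: tpermP => [->|->|/eqP/negPf-> /eqP/negPf->] //.
    + by rewrite eqxx eq_nu eqxx.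
    + by rewrite (negPf neq_ij) eq_sym (negPf neq_ij) eq_nu.
  apply: Fni; apply/injectivePn; exists i, j => //.
  by rewrite !ffunE eq_nu ![_ == l]eq_sym (negPf li) (negPf lj).
rewrite /down big1 // => l _; apply: (Fneg _ i); rewrite !ivecE.
by case: eqP => _; lia.
Qed.

Lemma fermionic_iter_down (M : zmodType) q r (F : ivec N -> M) :
  (forall x : M, x + x = 0) -> fermionic F -> fermionic (iter r (down q) F).
Proof. by move=> M2 fF; elim: r => //= r; apply: fermionic_down. Qed.

End DownOperators.

(** * The matching determinant *)

Definition staircase (N : nat) : ivec N := [ffun i : 'I_N => (i : nat)%:Z].

(* The sign of the permutation matching [nu] to [mu], and [0] if there is none *)
(* or if [nu] has repeated entries.                                           *)
Definition match_det (N : nat) (nu mu : ivec N) : int :=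
  \det (\matrix_(i, j) (nu i == mu j)%:Z).

Lemma bin2_succ n : ('C(n.+1, 2) = 'C(n, 2) + n)%N.
Proof. by rewrite binS bin1 addnC. Qed.

Lemma sum_uniq_ge (s : seq nat) : uniq s -> ('C(size s, 2) <= \sum_(x <- s) x)%N.
Proof.
move: {2}(size s) (erefl (size s)) => n.
elim: n s => [|n IHn] s sz_s us; first by rewrite sz_s bin0n.
have [x xs gex] : exists2 x, x \in s & (n <= x)%N.
  apply/hasP; rewrite -[has _ _]negbK -all_predC; apply/negP=> /allP lts.
  have: (size s <= size (iota 0 n))%N.
    by apply: uniq_leq_size => // x /lts /=; rewrite mem_iota -ltnNge.
  by rewrite size_iota sz_s ltnn.
rewrite (big_rem x) //=; have sz_r: size (rem x s) = n by rewrite size_rem // sz_s.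
rewrite sz_s bin2_succ addnC leq_add // -sz_r.
by apply: IHn; rewrite ?rem_uniq.
Qed.

Lemma eq_subr_addr (x y z : int) : (x == y - z) = (x + z == y).
Proof. by apply/eqP/eqP; lia. Qed.

Section MatchDet.
Variable N : nat.
Implicit Types (nu mu : ivec N) (q : nat) (s : {perm 'I_N}).

Lemma match_detE nu mu :
  match_det nu mu = \sum_(s : {perm 'I_N}) (-1) ^+ s * \prod_i (nu i == mu (s i))%:Z.
Proof. by apply: eq_bigr => s _; congr (_ * _); apply: eq_bigr => i _; rewrite mxE. Qed.

Lemma match_det_perml nu mu s :
  match_det [ffun i => nu (s i)] mu = (-1) ^+ s * match_det nu mu.
Proof.
rewrite -det_perm -det_mulmx -row_permE; congr (\det _).
by apply/matrixP=> i j; rewrite !mxE ffunE.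
Qed.

Lemma match_detC nu mu : match_det nu mu = match_det mu nu.
Proof. by rewrite /match_det -det_tr; congr (\det _); apply/matrixP=> i j; rewrite !mxE eq_sym. Qed.

Lemma match_det_noninj nu mu : ~~ injectiveb nu -> match_det nu mu = 0.
Proof.
case/injectivePn=> i [j neq_ij eq_nu]; apply: (determinant_alternate neq_ij) => l.
by rewrite !mxE eq_nu.
Qed.

Lemma match_det_unmatched nu mu i : (forall j, nu i != mu j) -> match_det nu mu = 0.
Proof.
move=> ne; rewrite /match_det (expand_det_row _ i) big1 // => j _.
by rewrite mxE (negPf (ne j)) mul0r.
Qed.

Lemma match_det_neg nu mu i : (forall j, 0 <= mu j) -> nu i < 0 -> match_det nu mu = 0.
Proof.
move=> mu_ge0 nui_lt0; apply: (@match_det_unmatched _ _ i) => j.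
by apply: contraTneq (mu_ge0 j) => <-; rewrite -ltNge.
Qed.

Lemma match_det_refl nu : injective nu -> match_det nu nu = 1.
Proof.
move=> inj_nu; rewrite /match_det (_ : \matrix_(i, j) _ = 1%:M) ?det1 //.
by apply/matrixP=> i j; rewrite !mxE (inj_eq inj_nu); case: eqP.
Qed.

Lemma staircase_ge0 (i : 'I_N) : 0 <= staircase N i.
Proof. by rewrite ffunE. Qed.

Lemma staircase_inj : injective (staircase N).
Proof. by move=> i j; rewrite !ffunE => -[/val_inj]. Qed.

Lemma ivec_perm nu mu : injective nu -> (forall i, exists j, nu i = mu j) ->
  exists s : {perm 'I_N}, nu = [ffun i => mu (s i)].
Proof.
move=> inj_nu sub; pose f i := odflt i [pick j | nu i == mu j].
have fE i : nu i = mu (f i).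
  rewrite /f; case: pickP => [j /eqP // | none].
  by case: (sub i) => j eq_ij; have:= none j; rewrite eq_ij eqxx.
have inj_f : injective f by move=> i j eqf; apply: inj_nu; rewrite !fE eqf.
by exists (perm inj_f); apply/ffunP=> i; rewrite ffunE permE.
Qed.

Lemma nonneg_inj_sum nu : injective nu -> (forall i, 0 <= nu i) ->
  'C(N, 2)%:Z <= \sum_i nu i.
Proof.
move=> inj_nu nu_ge0; pose s := [seq `|nu i|%N | i : 'I_N].
have us : uniq s.
  rewrite map_inj_in_uniq ?enum_uniq // => i j _ _ eq_ij; apply: inj_nu.
  by rewrite -(gez0_abs (nu_ge0 i)) -(gez0_abs (nu_ge0 j)) eq_ij.
have := sum_uniq_ge us; rewrite size_map -cardE card_ord.
rewrite big_map big_enum /= -lez_nat => /le_trans; apply.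
rewrite (big_morph Posz PoszD (erefl _)) le_eqVlt; apply/orP; left; apply/eqP.
by apply: eq_bigr => i _; rewrite gez0_abs.
Qed.

Lemma nonneg_inj_min nu : injective nu -> (forall i, 0 <= nu i) ->
  \sum_i nu i = 'C(N, 2)%:Z -> exists s : {perm 'I_N}, nu = [ffun i => staircase N (s i)].
Proof.
move=> inj_nu nu_ge0 sum_nu; apply: ivec_perm => // i.
suff lt_i : (`|nu i| < N)%N.
  by exists (Ordinal lt_i); rewrite ffunE /= gez0_abs.
case: N nu inj_nu nu_ge0 sum_nu i => [|N'] nu' inj_nu nu_ge0 sum_nu i; first by case: i.
(* Without entry [i] there remain N' distinct naturals, of sum at least ['C(N', 2)], so entry [i] is
   at most N'. *)
pose s := [seq `|nu' j|%N | j <- rem i (enum 'I_N'.+1)].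
have ue := enum_uniq 'I_N'.+1.
have us : uniq s.
  rewrite map_inj_in_uniq ?rem_uniq // => j l _ _ eq_jl; apply: inj_nu.
  by rewrite -(gez0_abs (nu_ge0 j)) -(gez0_abs (nu_ge0 l)) eq_jl.
have := sum_uniq_ge us; rewrite size_map size_rem ?mem_enum // -cardE card_ord big_map /=.
have: (\sum_(j <- enum 'I_N'.+1) `|nu' j| = 'C(N'.+1, 2))%N.
  apply/eqP; rewrite -eqz_nat -sum_nu (big_morph Posz PoszD (erefl _)) big_enum /=.
  by apply/eqP; apply: eq_bigr => j _; rewrite gez0_abs.
rewrite (big_rem i) ?mem_enum //= bin2_succ; lia.
Qed.

Lemma match_det_lt nu mu : (forall i, 0 <= nu i) -> \sum_i nu i < 'C(N, 2)%:Z ->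
  match_det nu mu = 0.
Proof.
move=> nu_ge0 lt_nu; apply: match_det_noninj; apply: contraTN lt_nu => /injectiveP inj.
by rewrite -leNgt nonneg_inj_sum.
Qed.

(** Degree zero of the Cauchy identity: [nu] is forced to be a rearrangement of the staircase, or to
    have a repeated entry. *)
Lemma match_det_staircase nu mu : (forall i, 0 <= nu i) -> \sum_i nu i = 'C(N, 2)%:Z ->
  match_det nu (staircase N) * match_det mu (staircase N) = match_det nu mu.
Proof.
move=> nu_ge0 sum_nu; have [/injectiveP inj|ninj] := boolP (injectiveb nu); last first.
  by rewrite !(match_det_noninj _ ninj) mul0r.
have [s ->] := nonneg_inj_min inj nu_ge0 sum_nu.
rewrite !match_det_perml (match_det_refl staircase_inj) mulr1.
by rewrite (match_detC mu).
Qed.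

(* Both sides count matched pairs with one entry of [mu] lowered by [q].      *)
Lemma match_det_adjoint nu mu q :
  \sum_j match_det nu (mu - spike q j) = \sum_l match_det (nu + spike q l) mu.
Proof.
under eq_bigr do rewrite match_detE.
under [RHS]eq_bigr do rewrite match_detE.
rewrite exchange_big [RHS]exchange_big /=; apply: eq_bigr => s _.
rewrite (reindex_inj (@perm_inj _ s)) /=; apply: eq_bigr => l _; congr (_ * _).
apply: eq_bigr => i _; rewrite !ivecE (inj_eq perm_inj); congr (nat_of_bool _)%:Z.
by case: (i =P l) => _; [exact: eq_subr_addr | rewrite subr0 addr0].
Qed.

Definition set_pair nu (i l : 'I_N) (x y : int) : ivec N :=
  [ffun j => if j == i then x else if j == l then y else nu j].

Lemma set_pairE nu i l x y j :
  set_pair nu i l x y j = if j == i then x else if j == l then y else nu j.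
Proof. by rewrite ffunE. Qed.

Lemma match_det_set_pairC nu mu i l x y : i != l ->
  match_det (set_pair nu i l x y) mu = - match_det (set_pair nu i l y x) mu.
Proof.
move=> ne_il; have -> : set_pair nu i l x y = [ffun j => set_pair nu i l y x (tperm i l j)].
  apply/ffunP=> j; rewrite set_pairE [RHS]ffunE set_pairE.
  by case: tpermP => [->|->|/eqP/negPf-> /eqP/negPf-> //];
    rewrite !eqxx [l == i]eq_sym (negPf ne_il).
by rewrite match_det_perml odd_tperm ne_il expr1 mulN1r.
Qed.

Lemma sum_hook_lengths (M : zmodType) (a Q : nat) (G : nat -> M) : (a <= Q)%N ->
  \sum_(1 <= q < Q.+1 | q%:Z <= a%:Z) G q = \sum_(0 <= x < a) G x.+1.
Proof.
by move=> le_aQ; rewrite -(big_add1 _ _ 0 a.+1 xpredT) [RHS](big_nat_widen _ _ Q.+1) //=.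
Qed.

(** Keep all entries but those at [i] and [l], and let these be x and a + b - x. The determinant
    changes sign under x -> a + b - x, so its sum over 0 <= x <= a + b is zero. The first sum covers
    x < a, the second x > a, and the missing term x = a is [nu] itself. *)
Lemma match_det_hop_pair nu mu (i l : 'I_N) (Q : nat) : i != l ->
  (forall j, 0 <= nu j) -> (forall j, nu j <= Q%:Z) ->
  \sum_(1 <= q < Q.+1 | q%:Z <= nu i) match_det (nu - spike q i + spike q l) mu
  + \sum_(1 <= q < Q.+1 | q%:Z <= nu l) match_det (nu - spike q l + spike q i) mu
  = - match_det nu mu.
Proof.
move=> ne_il nu_ge0 nu_le.
have [a nui] : exists a : nat, nu i = a by exists `|nu i|%N; rewrite gez0_abs.
have [b nul] : exists b : nat, nu l = b by exists `|nu l|%N; rewrite gez0_abs.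
have le_aQ : (a <= Q)%N by have := nu_le i; rewrite nui.
have le_bQ : (b <= Q)%N by have := nu_le l; rewrite nul.
pose F (x : nat) := match_det (set_pair nu i l x%:Z ((a + b)%N%:Z - x%:Z)) mu.
have F_anti x : (x <= a + b)%N -> F (a + b - x)%N = - F x.
  move=> le_x; rewrite /F -match_det_set_pairC //.
  by rewrite -subzn // opprB addrCA subrr addr0 ?[_ - _ + _]addrNK.
have sumF0 : \sum_(0 <= x < (a + b).+1) F x = 0.
  set S := LHS; have: S = - S.
    rewrite {1}/S big_nat_rev /= -sumrN; apply: eq_big_nat => x /andP[_ lt_x].
    by rewrite add0n subSS F_anti.
  lia.
have Fa : F a = match_det nu mu.
  congr match_det; apply/ffunP=> j; rewrite set_pairE.
  by case: eqP => [->|_]; [rewrite nui | case: eqP => // ->; rewrite nul; lia].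
have sum1 : \sum_(1 <= q < Q.+1 | q%:Z <= nu i) match_det (nu - spike q i + spike q l) mu
   = \sum_(0 <= x < a) F x.
  rewrite nui sum_hook_lengths // big_nat_rev; apply: eq_big_nat => x /andP[_ lt_x].
  congr match_det; apply/ffunP=> j; rewrite set_pairE !ivecE.
  case: (j =P i) => [->|nji]; first by rewrite (negPf ne_il) nui; lia.
  by case: (j =P l) => [->|njl]; rewrite ?nul; lia.
have sum2 : \sum_(1 <= q < Q.+1 | q%:Z <= nu l) match_det (nu - spike q l + spike q i) mu
   = \sum_(a.+1 <= x < (a + b).+1) F x.
  rewrite nul sum_hook_lengths // -{1}(add0n a.+1) big_addn subSS addKn.
  apply: eq_big_nat => x /andP[_ lt_x].
  congr match_det; apply/ffunP=> j; rewrite set_pairE !ivecE.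
  case: (j =P i) => [->|nji]; first by rewrite (negPf ne_il) nui; lia.
  by case: (j =P l) => [->|njl]; rewrite ?nul; lia.
rewrite sum1 sum2 -Fa; move: sumF0.
rewrite (@big_cat_nat _ _ _ a) //=; last by rewrite -addnS leq_addr.
rewrite (@big_ltn _ _ _ a) ?ltnS ?leq_addr // addrCA => /eqP.
by rewrite addr_eq0 => /eqP->; rewrite opprK.
Qed.

(* The energy identity of the fermionic Fock space: the terms in which two    *)
(* beads move cancel in pairs, up to one term per pair of beads.              *)
Lemma match_det_energy nu mu (Q : nat) :
  (forall j, 0 <= nu j) -> (forall j, nu j <= Q%:Z) ->
  \sum_(1 <= q < Q.+1) \sum_(i | q%:Z <= nu i) \sum_j match_det (nu - spike q i) (mu - spike q j)
  = (\sum_i nu i - 'C(N, 2)%:Z) * match_det nu mu.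
Proof.
move=> nu_ge0 nu_le.
under eq_bigr do under eq_bigr do rewrite match_det_adjoint.
pose T i l := \sum_(1 <= q < Q.+1 | q%:Z <= nu i) match_det (nu - spike q i + spike q l) mu.
have -> : \sum_(1 <= q < Q.+1) \sum_(i | q%:Z <= nu i) \sum_l
    match_det (nu - spike q i + spike q l) mu = \sum_i \sum_l T i l.
  under eq_bigr do rewrite big_mkcond.
  rewrite exchange_big /=; apply: eq_bigr => i _.
  rewrite -big_mkcond exchange_big /=; apply: eq_bigr => l _; exact: erefl.
have Tii i : T i i = nu i * match_det nu mu.
  have [a nui] : exists a : nat, nu i = a by exists `|nu i|%N; rewrite gez0_abs.
  have le_aQ : (a <= Q)%N by have := nu_le i; rewrite nui.
  rewrite /T (eq_bigr (fun=> match_det nu mu)) => [|q _]; last by rewrite subrK.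
  by rewrite nui sum_hook_lengths // sumr_const_nat subn0 -mulr_natl natz.
have T2 i l : i != l -> T i l + T l i = - match_det nu mu.
  by move=> ne; apply: match_det_hop_pair.
(* Doubling symmetrizes the sum, so that each unordered pair of beads contributes through
   [T i l + T l i]. *)
have dbl : (\sum_i \sum_l T i l) *+ 2 = \sum_i \sum_l (T i l + T l i).
  rewrite mulr2n {2}exchange_big -big_split; apply: eq_bigr => i _.
  by rewrite -big_split.
apply/eqP; rewrite -(eqr_pMn2r (isT : (0 < 2)%N)) dbl.
have row i : \sum_l (T i l + T l i) =
    (nu i * match_det nu mu) *+ 2 - match_det nu mu *+ N.-1.
  rewrite (bigD1 i) //= Tii -mulr2n; congr (_ + _).
  rewrite (eq_bigr (fun=> - match_det nu mu)) => [|l ne]; last by rewrite T2 // eq_sym.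
  by rewrite sumr_const mulNrn cardC1 card_ord.
under eq_bigr do rewrite row.
rewrite sumrB sumr_const card_ord sumrMnl -mulr_suml -mulrnA mulrBl mulrnBl.
have -> : (N.-1 * N = 'C(N, 2) * 2)%N.
  by elim: (N) => //= n IHn; rewrite bin2_succ; case: n IHn => //= n; lia.
by rewrite mulrnA [_%:Z * _]mulrC -natz mulr_natr.
Qed.
End MatchDet.

Lemma match_det_neq0 M (nu mu : ivec M) : match_det nu mu != 0 ->
  exists s : {perm 'I_M}, nu = [ffun i => mu (s i)].
Proof.
move=> nz; have [s /forallP eq_s|none] := pickP (fun s : {perm 'I_M} => [forall i, nu i == mu (s i)]).
  by exists s; apply/ffunP=> i; rewrite ffunE; apply/eqP.
case/eqP: nz; rewrite match_detE big1 // => s _.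
have /forallPn[i ne_i] := negbT (none s).
by rewrite (bigD1 i) //= (negPf ne_i) mul0r mulr0.
Qed.

Lemma match_det_sum_neq M (nu mu : ivec M) : \sum_i nu i != \sum_i mu i -> match_det nu mu = 0.
Proof.
apply: contraNeq => /match_det_neq0[s ->]; apply/eqP.
by rewrite [RHS](reindex_inj (@perm_inj _ s)); apply: eq_bigr => i _; rewrite ffunE.
Qed.

(** * Contents and the Cauchy identity *)

Section ContentSums.
Variables (P : finType) (B : nat).

Definition add_at (m : {ffun P -> nat}) (q : nat) (p : P) : {ffun P -> nat} :=
  [ffun r => if r == p then (m r + q)%N else m r].

(** The bound [B] makes the index type finite; for [n <= B] it excludes no content of total [n]. *)
Definition content_sum (n : nat) (Psi : {ffun P -> nat} -> int) : int :=
  \sum_(m : {ffun P -> 'I_B.+1} | (\sum_p m p)%N == n) Psi [ffun p => m p : nat].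

Lemma sum_add_at (m : {ffun P -> nat}) q p :
  (\sum_r add_at m q p r = \sum_r m r + q)%N.
Proof.
rewrite (bigD1 p) //= [in RHS](bigD1 p) //= ffunE eqxx -!addnA; congr (_ + _)%N.
by rewrite addnC; congr (_ + _)%N; apply: eq_bigr => r ne; rewrite ffunE (negPf ne).
Qed.

Lemma content_sum_shift n (Psi : {ffun P -> nat} -> int) q p : (n <= B)%N -> (0 < q <= n)%N ->
  \sum_(m : {ffun P -> 'I_B.+1} | ((\sum_p m p)%N == n) && (q <= m p)%N) Psi [ffun p => m p : nat]
  = content_sum (n - q) (fun m => Psi (add_at m q p)).
Proof.
move=> le_nB /andP[q_gt0 le_qn].
pose up (m : {ffun P -> 'I_B.+1}) : {ffun P -> 'I_B.+1} :=
  [ffun r => if r == p then inord (m r + q) else m r].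
pose dn (m : {ffun P -> 'I_B.+1}) : {ffun P -> 'I_B.+1} :=
  [ffun r => if r == p then inord (m r - q) else m r].
have upE (m : {ffun P -> 'I_B.+1}) : (m p + q <= B)%N ->
    [ffun r => up m r : nat] = add_at [ffun r => m r : nat] q p.
  by move=> le; apply/ffunP=> r; rewrite !ffunE; case: eqP => [->|//]; rewrite inordK.
rewrite (reindex_onto up dn) /=; last first.
  move=> m /andP[_ le_q]; apply/ffunP=> r; rewrite !ffunE; case: eqP => [->|//].
  by apply/val_inj; rewrite /= ?eqxx inordK inordK ?subnK // ltnS ?(leq_trans (leq_subr _ _)) // -ltnS.
have le_sum (m : {ffun P -> 'I_B.+1}) : (m p <= \sum_r m r)%N.
  by rewrite (bigD1 p) //= leq_addr.
rewrite /content_sum; apply: eq_big => [m|m cond].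
  (* On overflow [inord] falls back to 0, which violates [q <= m p] on the left; on the right the
     total n - q already rules overflow out. *)
  have [le|gt] := leqP (m p + q) B; last first.
    rewrite ffunE eqxx /inord /insubd insubF /=; last by rewrite ltnS leqNgt gt.
    rewrite leqNgt q_gt0 /= andbF; apply/esym/negP=> /eqP sum_m.
    by have := le_sum m; lia.
  have -> : dn (up m) = m.
    apply/ffunP=> r; rewrite !ffunE; case: eqP => [->|//].
    by apply/val_inj; rewrite /= inordK inordK ?addnK.
  have -> : (\sum_r up m r = \sum_r m r + q)%N.
    transitivity (\sum_r [ffun r => up m r : nat] r)%N.
      by apply: eq_bigr => r _; rewrite ffunE.
    by rewrite upE // sum_add_at; congr (_ + _)%N; apply: eq_bigr => r _; rewrite ffunE.
  rewrite eqxx andbT ffunE eqxx inordK // leq_addl andbT.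
  by rewrite -[X in _ == X](subnK le_qn) eqn_add2r.
rewrite upE //; case/andP: cond => /andP[_].
rewrite ffunE eqxx /inord /insubd; case: insubP => [u _ val_u|_ /=]; last by rewrite leqNgt q_gt0.
by move=> _ _; rewrite -ltnS -val_u; apply: (ltn_ord u).
Qed.

(* Euler's identity: grading each content by its total amounts to peeling off *)
(* [q] units of some part [p] in all possible ways.                           *)
Lemma content_sum_euler n (Psi : {ffun P -> nat} -> int) : (n <= B)%N ->
  n%:Z * content_sum n Psi
  = \sum_(1 <= q < n.+1) \sum_p content_sum (n - q) (fun m => Psi (add_at m q p)).
Proof.
move=> le_nB; pose c (m : {ffun P -> 'I_B.+1}) := Psi [ffun p => m p : nat].
transitivity (\sum_(m : {ffun P -> 'I_B.+1} | (\sum_p m p)%N == n)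
    \sum_p \sum_(1 <= q < n.+1 | (q <= m p)%N) c m).
  rewrite mulr_sumr; apply: eq_bigr => m /eqP sum_m.
  rewrite -{1}sum_m (big_morph Posz PoszD (erefl _)) mulr_suml; apply: eq_bigr => p _.
  have le_mp : (m p <= n)%N by rewrite -sum_m (bigD1 p) //= leq_addr.
  rewrite (eq_bigl (fun q => q%:Z <= (m p : nat)%:Z)) // (sum_hook_lengths _ le_mp).
  by rewrite sumr_const_nat subn0 -mulr_natl natz.
rewrite exchange_big /=.
under eq_bigr => p _ do under eq_bigr => m _ do rewrite big_mkcond.
under eq_bigr => p _ do rewrite exchange_big /=.
rewrite exchange_big /=; apply: eq_big_nat => q /andP[q_gt0 lt_q].
apply: eq_bigr => p _; rewrite -content_sum_shift ?q_gt0 //.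
by rewrite -big_mkcondr.
Qed.

End ContentSums.

Section Cauchy.
Variables (N B : nat).
Implicit Types (nu mu : ivec N).

Definition row_content (m : {ffun 'I_N * 'I_N -> nat}) : ivec N :=
  [ffun i => (\sum_j m (i, j))%N%:Z].
Definition col_content (m : {ffun 'I_N * 'I_N -> nat}) : ivec N :=
  [ffun j => (\sum_i m (i, j))%N%:Z].

Lemma row_add_at m q p : row_content (add_at m q p) = row_content m + spike q p.1.
Proof.
apply/ffunP=> i; rewrite !ffunE; case: p => a b /=; case: eqP => [->|ne].
  rewrite (bigD1 b) //= [in RHS](bigD1 b) //= ffunE eqxx -PoszD addnAC; congr (_ + _ + _)%N%:Z.
  by apply: eq_bigr => j ne; rewrite ffunE xpair_eqE (negPf ne) andbF.
by rewrite addr0; congr Posz; apply: eq_bigr => j _; rewrite ffunE xpair_eqE; case: eqP ne.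
Qed.

Lemma col_add_at m q p : col_content (add_at m q p) = col_content m + spike q p.2.
Proof.
apply/ffunP=> i; rewrite !ffunE; case: p => a b /=; case: eqP => [->|ne].
  rewrite (bigD1 a) //= [in RHS](bigD1 a) //= ffunE eqxx -PoszD addnAC; congr (_ + _ + _)%N%:Z.
  by apply: eq_bigr => j ne; rewrite ffunE xpair_eqE (negPf ne).
by rewrite addr0; congr Posz; apply: eq_bigr => j _; rewrite ffunE xpair_eqE; case: (i =P b) ne; rewrite ?andbF.
Qed.

Lemma match_det_sub_neg nu (c : ivec N) i : (forall j, 0 <= c j) -> nu i < 0 ->
  match_det (nu - c) (staircase N) = 0.
Proof.
move=> c_ge0 nui_lt0; apply: (@match_det_neg _ _ _ i); first exact: staircase_ge0.
by rewrite !ivecE; have := c_ge0 i; lia.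
Qed.

(* A coefficientwise form of the Cauchy determinant identity.                 *)
Lemma cauchy_match_det n nu mu : (n <= B)%N ->
  (forall i, 0 <= nu i) -> (forall i, 0 <= mu i) ->
  \sum_i nu i = n%:Z + 'C(N, 2)%:Z ->
  content_sum B n (fun m => match_det (nu - row_content m) (staircase N)
                          * match_det (mu - col_content m) (staircase N))
  = match_det nu mu.
Proof.
elim/ltn_ind: n nu mu => -[|n] IHn nu mu le_nB nu_ge0 mu_ge0 sum_nu.
  rewrite add0r in sum_nu; rewrite -match_det_staircase // /content_sum.
  pose z : {ffun 'I_N * 'I_N -> 'I_B.+1} := [ffun=> ord0].
  rewrite (big_pred1 z) => [|m]; last first.
    rewrite sum_nat_eq0; apply/forallP/eqP => [m0|-> p]; last by rewrite ffunE.
    by apply/ffunP=> p; rewrite ffunE; apply/val_inj/eqP; have:= m0 p.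
  rewrite /=; congr (_ * _); congr match_det; apply/ffunP=> i;
    by rewrite !ffunE big1 ?subr0 // => j _; rewrite !ffunE.
(* After multiplication by n + 1, Euler's identity expands the left side and the energy identity the
   right side; the induction hypothesis matches them term by term in q, i and j. *)
apply/eqP; rewrite -(inj_eq (mulfI (_ : n.+1%:Z != 0))) // content_sum_euler //.
pose Q := (n.+1 + 'C(N, 2))%N.
have nu_leQ i : nu i <= Q%:Z.
  rewrite PoszD -sum_nu (bigD1 i) //= -[X in X <= _]addr0 lerD2l.
  by apply: sumr_ge0 => j _; apply: nu_ge0.
have := match_det_energy mu nu_ge0 nu_leQ.
rewrite sum_nu addrK => <-.
(* The energy sum runs up to the bound [Q] on the entries, but for q > n + 1 lowering drops the
   total below ['C(N, 2)] and the determinant vanishes. *)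
rewrite [X in _ == X](@big_cat_nat _ _ _ n.+2) //=; last by rewrite ltnS /Q leq_addr.
rewrite [X in _ == _ + X]big_nat_cond [X in _ == _ + X]big1 => [|q /andP[/andP[lt_nq _] _]]; last first.
  apply: big1 => i le_q; apply: big1 => j _; apply: match_det_lt => [l|].
    by rewrite !ivecE; case: eqP => [->|_]; rewrite ?subr0 // subr_ge0.
  under eq_bigr do rewrite ivecD ivecN.
  rewrite sumrB sum_nu (bigD1 i) //= spikeE eqxx big1 => [|l /negPf ne]; last by rewrite spikeE ne.
  by rewrite addr0; lia.
rewrite addr0; apply/eqP; apply: eq_big_nat => q /andP[q_gt0 lt_q].
rewrite -(pair_bigA _ (fun i j => content_sum B (n.+1 - q) (fun m =>
   match_det (nu - row_content (add_at m q (i, j))) (staircase N) *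
   match_det (mu - col_content (add_at m q (i, j))) (staircase N)))) /=.
rewrite [RHS]big_mkcond; apply: eq_bigr => i _.
have rowC_ge0 m l : 0 <= row_content m l by rewrite ffunE.
have colC_ge0 m l : 0 <= col_content m l by rewrite ffunE.
have shiftE j m : match_det (nu - row_content (add_at m q (i, j))) (staircase N) *
   match_det (mu - col_content (add_at m q (i, j))) (staircase N)
   = match_det (nu - spike q i - row_content m) (staircase N) *
     match_det (mu - spike q j - col_content m) (staircase N).
  by rewrite row_add_at col_add_at /= !opprD !(addrA nu) !(addrA mu) !(addrAC _ (- row_content m)) !(addrAC _ (- col_content m)).
have [le_q|gt_q] := boolP (q%:Z <= nu i); last first.
  apply: big1 => j _; apply: big1 => m _; rewrite shiftE.
  rewrite (@match_det_sub_neg _ _ i) ?mul0r // !ivecE eqxx.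
  by rewrite subr_lt0 ltNge.
apply: eq_bigr => j _.
have [le_qj|gt_qj] := boolP (q%:Z <= mu j); last first.
  rewrite match_detC (@match_det_neg _ _ _ j) => [||]; last first.
  - by rewrite !ivecE eqxx subr_lt0 ltNge.
  - by move=> l; rewrite !ivecE; case: eqP => [->|_]; rewrite ?subr0 // subr_ge0.
  apply: big1 => m _; rewrite shiftE mulrC (@match_det_sub_neg _ _ j) ?mul0r // !ivecE eqxx.
  by rewrite subr_lt0 ltNge.
have IH := IHn (n.+1 - q)%N _ (nu - spike q i) (mu - spike q j).
rewrite -{}IH.
- by apply: eq_bigr => m _; apply: shiftE.
- by lia.
- by lia.
- by move=> l; rewrite !ivecE; case: eqP => [->|_]; rewrite ?subr0 // subr_ge0.
- by move=> l; rewrite !ivecE; case: eqP => [->|_]; rewrite ?subr0 // subr_ge0.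
under eq_bigr do rewrite ivecD ivecN.
rewrite sumrB sum_nu (bigD1 i) //= spikeE eqxx big1 => [|l /negPf ne]; last by rewrite spikeE ne.
by rewrite addr0 -subzn //; lia.
Qed.

End Cauchy.

(** * Colourings *)

Section Colourings.
Variables (T P : finType) (d0 : P).
Implicit Types (A : {set T}) (h : {ffun T -> P}) (g : {perm T}).

(* Colourings of [A], extended by the junk colour [d0] outside [A].           *)
Definition colouring A h := [forall x, (x \notin A) ==> (h x == d0)].

Definition invariant_col g h := [forall x, h (g x) == h x].

Definition content A h : {ffun P -> nat} := [ffun d => \sum_(x in A) (h x == d)]%N.

Definition recolour h g : {ffun T -> P} := [ffun x => h (g x)].

Lemma invariant_colE g h : invariant_col g h = (recolour h g == h).
Proof.
apply/forallP/eqP => [inv|eq_h x]; first by apply/ffunP=> x; rewrite ffunE; apply/eqP.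
by rewrite -{2}eq_h ffunE.
Qed.

Lemma recolourM h g1 g2 : recolour h (g1 * g2)%g = recolour (recolour h g2) g1.
Proof. by apply/ffunP=> x; rewrite !ffunE permM. Qed.

Lemma recolour1 h : recolour h 1%g = h.
Proof. by apply/ffunP=> x; rewrite !ffunE perm1. Qed.

Lemma Sym_closed A g x : g \in Sym A -> (g x \in A) = (x \in A).
Proof. by rewrite inE => /perm_closed ->. Qed.

Lemma content_recolour A h g : g \in Sym A -> content A (recolour h g) = content A h.
Proof.
move=> Ag; apply/ffunP=> d; rewrite !ffunE [RHS](reindex_inj (@perm_inj _ g)) /=.
by apply: eq_big => x; rewrite ?Sym_closed // ffunE.
Qed.

Lemma colouring_recolour A h g : g \in Sym A -> colouring A (recolour h g) = colouring A h.
Proof.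
move=> Ag; apply/forallP/forallP => col x; last by rewrite ffunE -(Sym_closed x Ag); apply: col.
by have := col ((g^-1)%g x); rewrite ffunE permKV -(Sym_closed _ Ag) permKV.
Qed.

Lemma sum_content A h : (\sum_d content A h d)%N = #|A|.
Proof.
under eq_bigr do rewrite ffunE.
rewrite exchange_big /= -sum1_card; apply: eq_bigr => x _.
by rewrite (bigD1 (h x)) //= eqxx big1 ?addn0 // => d; rewrite eq_sym => /negPf->.
Qed.

Lemma content_le A h d : (content A h d <= #|A|)%N.
Proof. by rewrite -(sum_content A h) (bigD1 d) //= leq_addr. Qed.

Lemma content_exists A (m : P -> nat) : (\sum_d m d)%N = #|A| ->
  exists h, colouring A h /\ forall d, content A h d = m d.
Proof.
elim: {A}#|A| {-2}A (erefl #|A|) m => [|n IHn] A cA m sum_m.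
  exists [ffun=> d0]; split=> [|d]; first by apply/forallP=> x; rewrite ffunE eqxx implybT.
  rewrite ffunE (cards0_eq cA) big_set0; apply/esym/eqP.
  by move/eqP: sum_m; rewrite cA sum_nat_eq0 => /forallP/(_ d).
have [a aA] : exists a, a \in A by apply/set0Pn; rewrite -card_gt0 cA.
have [d md] : exists d, (0 < m d)%N.
  apply/existsP; rewrite -[[exists _, _]]negbK negb_exists; apply/negP=> /forallP m0.
  by move: sum_m; rewrite cA big1 // => d _; apply/eqP; rewrite -leqn0 leqNgt.
have cA' : #|A :\ a| = n by apply/eqP; rewrite -eqSS -cA (cardsD1 a A) aA.
have [|h [col ch]] := IHn (A :\ a) cA' (fun e => if e == d then (m d).-1 else m e).
  move: sum_m; rewrite cA cA' (bigD1 d) //= => sum_m.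
  rewrite (bigD1 d) //= eqxx -[RHS]/(n.+1.-1) -sum_m -(prednK md) addSn /=.
  by congr (_ + _)%N; apply: eq_bigr => e /negPf->.
exists [ffun x => if x == a then d else h x]; split=> [|e].
  apply/forallP=> x; apply/implyP=> xA; rewrite ffunE.
  have /negPf-> : x != a by apply: contraNneq xA => ->.
  by move/forallP/(_ x)/implyP: col; apply; rewrite !inE negb_and xA orbT.
rewrite ffunE (big_setD1 a) //= ffunE eqxx.
have := ch e; rewrite ffunE => sum_e.
rewrite (eq_bigr (fun x => nat_of_bool (h x == e))) => [|x]; last first.
  by rewrite !inE ffunE => /andP[/negPf-> _].
by rewrite sum_e [d == e]eq_sym; case: eqP => [->|_] //=; rewrite add1n prednK.
Qed.

Lemma content_transitive A h h0 : content A h = content A h0 ->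
  exists2 p, p \in Sym A & {in A, forall x, h x = h0 (p x)}.
Proof.
elim: {A}#|A| {-2}A (erefl #|A|) h h0 => [|n IHn] A cA h h0 eqc.
  exists 1%g; first by rewrite inE perm_on1.
  by move=> x; rewrite (cards0_eq cA) inE.
have [a aA] : exists a, a \in A by apply/set0Pn; rewrite -card_gt0 cA.
have [b bA /eqP hb] : exists2 b, b \in A & h0 b == h a.
  apply/exists_inP; rewrite -[[exists _ in _, _]]negbK negb_exists_in.
  apply/negP=> /forall_inP nh; have := congr1 (fun c : {ffun P -> nat} => c (h a)) eqc.
  rewrite !ffunE (big_setD1 a) //= eqxx [X in _ = X]big1 // => x /nh/negPf-> //.
have cA' : #|A :\ a| = n by apply/eqP; rewrite -eqSS -cA (cardsD1 a A) aA.
have At : tperm a b \in Sym A.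
  rewrite inE; apply/subsetP=> x; rewrite !inE; case: tpermP => [-> //|-> //|].
  by rewrite eqxx.
have [|p Ap hp] := IHn (A :\ a) cA' h (recolour h0 (tperm a b)).
  apply/ffunP=> d; have := congr1 (fun c : {ffun P -> nat} => c d) eqc.
  rewrite -(content_recolour h0 At) !ffunE !(big_setD1 a aA) /= ffunE tpermL hb.
  by move/addnI.
exists (p * tperm a b)%g.
  rewrite groupM //; move: Ap; rewrite !inE => /subset_trans; apply; exact: subD1set.
move=> x xA; rewrite permM; have [->|nxa] := eqVneq x a.
  have -> : p a = a.
    apply: (out_perm (S := A :\ a)); first by move: Ap; rewrite inE.
    by rewrite !inE eqxx.
  by rewrite tpermL hb.
by rewrite hp ?inE ?nxa // ffunE.
Qed.

Lemma colouring_transitive A h h0 : colouring A h -> colouring A h0 ->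
  content A h = content A h0 -> exists2 p, p \in Sym A & recolour h0 p = h.
Proof.
move=> col col0 /content_transitive[p Ap hp]; exists p => //.
apply/ffunP=> x; rewrite ffunE; have [xA|xA] := boolP (x \in A); first by rewrite hp.
have /eqP-> : h x == d0 by move/forallP/(_ x)/implyP: col; apply.
by apply/eqP; move/forallP/(_ (p x))/implyP: col0; apply; rewrite Sym_closed.
Qed.

(** Translation by [p] matches the stabilizer of [h] with the transporters from [h0] to [h]; the
    latter, summed over the orbit of [h0], exhaust [Sym A]. *)
Lemma card_invariant A h h0 p : p \in Sym A -> recolour h0 p = h ->
  (\sum_(g in Sym A) invariant_col g h = \sum_(g in Sym A) (recolour h0 g == h))%N.
Proof.
move=> Ap eq_h; rewrite [RHS](reindex_inj (mulIg p)) /=.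
apply: eq_big => g; first by rewrite groupMr.
by rewrite invariant_colE recolourM eq_h.
Qed.

(* Burnside's lemma for the action of [Sym A], whose orbits on colourings are *)
(* classified by their content.                                               *)
Lemma burnside_content A B (Psi : {ffun P -> nat} -> int) : (#|A| <= B)%N ->
  \sum_(g in Sym A) \sum_(h | colouring A h && invariant_col g h) Psi (content A h)
  = #|Sym A|%:Z * content_sum B #|A| Psi.
Proof.
move=> le_AB.
have -> : \sum_(g in Sym A) \sum_(h | colouring A h && invariant_col g h) Psi (content A h)
  = \sum_(h | colouring A h) Psi (content A h) * (\sum_(g in Sym A) invariant_col g h)%N%:Z.
  under eq_bigr do rewrite big_mkcondr /=.
  rewrite exchange_big /=; apply: eq_bigr => h _.
  rewrite (big_morph Posz PoszD (erefl _)) mulr_sumr; apply: eq_bigr => g _.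
  by case: invariant_col; rewrite ?mulr1 ?mulr0.
pose c h : {ffun P -> 'I_B.+1} := [ffun d => inord (content A h d)].
have cE h d : c h d = content A h d :> nat.
  by rewrite ffunE inordK // ltnS (leq_trans (content_le _ _ _)).
have c_eq h m : (c h == m) = (content A h == [ffun d => m d : nat]).
  apply/eqP/eqP => [<-|eqc]; first by apply/ffunP=> d; rewrite [RHS]ffunE cE.
  by apply/ffunP=> d; apply/val_inj; rewrite /= cE eqc ffunE.
rewrite (partition_big c (fun m => (\sum_d m d)%N == #|A|)) /=; last first.
  by move=> h _; rewrite -(sum_content A h); apply/eqP/eq_bigr => d _; apply: cE.
rewrite /content_sum mulr_sumr; apply: eq_bigr => m /eqP/esym sum_m.
have [h0 [col0 ch0]] := content_exists (esym sum_m).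
have ch0E : content A h0 = [ffun d => m d : nat] by apply/ffunP=> d; rewrite ch0 ffunE.
transitivity (\sum_(h | colouring A h && (c h == m))
    (\sum_(g in Sym A) (recolour h0 g == h))%N%:Z * Psi [ffun d => m d : nat]).
  apply: eq_bigr => h /andP[col]; rewrite c_eq => /eqP ch; rewrite ch mulrC; congr (_%:Z * _).
  have [|p Ap eq_h] := colouring_transitive col col0; first by rewrite ch0E.
  exact: card_invariant eq_h.
rewrite -mulr_suml -(big_morph Posz PoszD (erefl _)); congr (_%:Z * _).
rewrite exchange_big -sum1_card /=; apply: eq_bigr => g Ag.
rewrite (bigD1 (recolour h0 g)) /=; last first.
  by rewrite colouring_recolour // col0 c_eq content_recolour // ch0E eqxx.
rewrite eqxx big1 // => h /andP[_]; rewrite eq_sym => /negPf-> //.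
Qed.

End Colourings.

(** * Frobenius' formula *)

Section SchurValues.
Variables (T : finType) (N : nat).
Implicit Types (A B : {set T}) (h : {ffun T -> 'I_N.+1}) (g : {perm T}) (nu mu : ivec N.+1).

Definition icontent A h : ivec N.+1 := [ffun i => (content A h i)%:Z].

(* The coefficient of [x ^ nu] in the power sum of the cycle type of [g] on   *)
(* [A] times the Vandermonde determinant: Frobenius' formula for the          *)
(* irreducible character labelled by the beta-set of [nu].                    *)
Definition schur_val A nu g : int :=
  \sum_(h | colouring ord0 A h && invariant_col g h)
    match_det (nu - icontent A h) (staircase N.+1).

Lemma sum_staircase M : \sum_i staircase M i = 'C(M, 2)%:Z.
Proof.
under eq_bigr do rewrite ffunE.
by rewrite -(big_morph Posz PoszD (erefl _)) -(big_mkord xpredT id) -bin2_sum.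
Qed.

Lemma sum_icontent A h : \sum_i icontent A h i = #|A|%:Z.
Proof.
under eq_bigr do rewrite ffunE.
by rewrite -(big_morph Posz PoszD (erefl _)) sum_content.
Qed.

Lemma schur_val_neg A nu g i : nu i < 0 -> schur_val A nu g = 0.
Proof.
move=> neg; apply: big1 => h _; apply: (@match_det_sub_neg _ _ _ i) => // j.
by rewrite ffunE.
Qed.

Lemma schur_val_size A nu g : \sum_i nu i != #|A|%:Z + 'C(N.+1, 2)%:Z -> schur_val A nu g = 0.
Proof.
move=> ne; apply: big1 => h _; apply: match_det_sum_neq.
under eq_bigr do rewrite ivecD ivecN.
by rewrite sumrB sum_icontent sum_staircase subr_eq addrC.
Qed.

(** Two colourings are one colouring by pairs, whose content is a matrix with the two contents as
    row and column sums: the shape required by the Cauchy identity. *)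
Lemma schur_val_mul A nu mu g :
  schur_val A nu g * schur_val A mu g =
  \sum_(h : {ffun T -> 'I_N.+1 * 'I_N.+1} | colouring (ord0, ord0) A h && invariant_col g h)
    match_det (nu - row_content (content A h)) (staircase N.+1) *
    match_det (mu - col_content (content A h)) (staircase N.+1).
Proof.
rewrite /schur_val big_distrlr /= pair_big /=.
pose split2 (h : {ffun T -> 'I_N.+1 * 'I_N.+1}) :
  {ffun T -> 'I_N.+1} * {ffun T -> 'I_N.+1} := ([ffun x => (h x).1], [ffun x => (h x).2]).
rewrite (reindex split2) /=; last first.
  exists (fun hh : {ffun T -> 'I_N.+1} * {ffun T -> 'I_N.+1} => [ffun x => (hh.1 x, hh.2 x)]) => [h _|[h1 h2] _].
    by apply/ffunP=> x; rewrite !ffunE -surjective_pairing.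
  by congr (_, _); apply/ffunP=> x; rewrite !ffunE.
apply: eq_big => [h|h _].
  apply/idP/idP=> [/andP[/andP[/forallP c1 /forallP i1] /andP[/forallP c2 /forallP i2]]|].
    apply/andP; split; apply/forallP=> x.
      apply/implyP=> xA; have := c1 x; have := c2 x; rewrite xA !ffunE /= => /eqP e2 /eqP e1.
      by apply/eqP; rewrite [LHS]surjective_pairing e1 e2.
    have := i1 x; have := i2 x; rewrite !ffunE => /eqP e2 /eqP e1.
    by apply/eqP; rewrite [LHS]surjective_pairing e1 e2 -surjective_pairing.
  case/andP=> /forallP c /forallP i.
  apply/andP; split; apply/andP; split; apply/forallP=> x; rewrite !ffunE ?(eqP (i x)) //.
    by apply/implyP=> xA; have := c x; rewrite xA => /eqP->.
  by apply/implyP=> xA; have := c x; rewrite xA => /eqP->.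
congr (_ * _); congr match_det; congr (_ - _); apply/ffunP=> i; rewrite !ffunE; congr Posz.
  under [RHS]eq_bigr do rewrite ffunE.
  rewrite exchange_big; apply: eq_bigr => x _; rewrite ffunE /=.
  case: (h x) => a b; rewrite (bigD1 b) //= xpair_eqE eqxx andbT big1 ?addn0 //.
  by move=> j; rewrite xpair_eqE [b == j]eq_sym => /negPf->; rewrite andbF.
under [RHS]eq_bigr do rewrite ffunE.
rewrite exchange_big; apply: eq_bigr => x _; rewrite ffunE /=.
case: (h x) => a b; rewrite (bigD1 a) //= xpair_eqE eqxx big1 ?addn0 //.
by move=> j; rewrite xpair_eqE [a == j]eq_sym => /negPf->.
Qed.

(** Orthogonality of characters: Burnside's lemma turns the average over [Sym A] into a content sum,
    which the Cauchy identity evaluates. *)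
Lemma sum_schur_val_mul A nu mu :
  (forall i, 0 <= mu i) -> \sum_i mu i = #|A|%:Z + 'C(N.+1, 2)%:Z ->
  \sum_(g in Sym A) schur_val A nu g * schur_val A mu g = #|Sym A|%:Z * match_det nu mu.
Proof.
move=> mu_ge0 sum_mu.
have [/forallP nu_ge0|/forallPn[i]] := boolP [forall i, 0 <= nu i]; last first.
  rewrite -ltNge => neg; rewrite (match_det_neg mu_ge0 neg) mulr0 big1 // => g _.
  by rewrite (schur_val_neg _ _ neg) mul0r.
have [sum_nu|ne] := eqVneq (\sum_i nu i) (#|A|%:Z + 'C(N.+1, 2)%:Z); last first.
  rewrite match_det_sum_neq ?sum_mu // mulr0 big1 // => g _.
  by rewrite schur_val_size ?mul0r.
under eq_bigr do rewrite schur_val_mul.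
rewrite -(cauchy_match_det (leqnn #|A|) nu_ge0 mu_ge0 sum_nu).
exact: (burnside_content (ord0, ord0) _ (leqnn _)).
Qed.

(** Since [g] fixes [a], the colour i of [a] is free, and it adds [spike 1 i] to the content. *)
Lemma schur_val_branch B a nu g : a \notin B -> g \in Sym B ->
  schur_val (a |: B) nu g = down 1 (schur_val B ^~ g) nu.
Proof.
move=> aB Bg; have ga : g a = a by move: Bg; rewrite inE => /out_perm->.
rewrite /schur_val /down (partition_big (fun h : {ffun T -> 'I_N.+1} => h a) xpredT) //=.
apply: eq_bigr => i _.
pose up h : {ffun T -> 'I_N.+1} := [ffun x => if x == a then i else h x].
pose dn h : {ffun T -> 'I_N.+1} := [ffun x => if x == a then ord0 else h x].
rewrite (reindex_onto up dn) /=; last first.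
  by move=> h /andP[_ /eqP ha]; apply/ffunP=> x; rewrite !ffunE; case: eqP => [->|].
have g_fix x : (g x == a) = (x == a) by rewrite -{1}ga (inj_eq perm_inj).
apply: eq_big => [h|h].
  apply/idP/idP.
    case/andP=> /andP[/andP[/forallP col /forallP inv] _] /eqP dnup.
    have ha : h a = ord0 by rewrite -dnup ffunE eqxx.
    apply/andP; split; apply/forallP=> x.
      apply/implyP=> xB; have [->|ne] := eqVneq x a; first by rewrite ha.
      by have := col x; rewrite !inE ffunE (negPf ne) xB.
    have := inv x; rewrite !ffunE g_fix; case: (x =P a) => [->|//]; by rewrite ga.
  case/andP=> /forallP col /forallP inv.
  have /eqP ha : h a == ord0 by have := col a; rewrite aB.
  rewrite ffunE !eqxx andbT; apply/andP; split; last first.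
    by apply/eqP/ffunP=> x; rewrite !ffunE; case: eqP => [->|].
  apply/andP; split; apply/forallP=> x.
    rewrite !inE negb_or ffunE; case: (x =P a) => [->//|_] /=; exact: col.
  rewrite !ffunE g_fix; case: (x =P a) => // _; exact: inv.
move=> _; rewrite -addrA -opprD; congr (match_det (_ - _) _).
apply/ffunP=> j; rewrite !ffunE big_setU1 //= ffunE eqxx PoszD; congr (_ + _).
  by rewrite eq_sym; case: eqP.
congr Posz; apply: eq_bigr => x xB; rewrite ffunE.
by rewrite (_ : x == a = false) //; apply: contraNF aB => /eqP<-.
Qed.

Lemma schur_val_restrict A B nu g : B \subset A -> g \in Sym B ->
  schur_val A nu g = iter #|A :\: B| (down 1) (schur_val B ^~ g) nu.
Proof.
move cAB : #|A :\: B| => n; elim: n A nu cAB => [|n IHn] A nu cAB sBA Bg.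
  have -> : A = B by apply/eqP; rewrite eqEsubset sBA andbT -setD_eq0 -cards_eq0 cAB.
  by [].
have [a] : exists a, a \in A :\: B by apply/set0Pn; rewrite -card_gt0 cAB.
rewrite inE => /andP[aB aA].
rewrite -{1}(setD1K aA) schur_val_branch ?inE ?eqxx //; last first.
  move: Bg; rewrite !inE => /subset_trans; apply; apply/subsetP=> x xB.
  by rewrite !inE (subsetP sBA) // andbT; apply: contraNneq aB => <-.
apply: eq_down => mu; apply: IHn => //.
  apply/eqP; rewrite -eqSS -cAB (cardsD1 a (A :\: B)) !inE aA aB /= add1n eqSS.
  by apply/eqP; congr #|pred_of_set _|; apply/setP=> x; rewrite !inE; do !case: (_ \in _); case: eqP.
apply/subsetP=> x xB; rewrite !inE (subsetP sBA) // andbT; apply: contraNneq aB => <- //.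
Qed.

Lemma schur_val_set0 nu g : schur_val set0 nu g = match_det nu (staircase N.+1).
Proof.
rewrite /schur_val (big_pred1 [ffun=> ord0]) => [|h].
  congr match_det; apply/ffunP=> i; rewrite !ffunE big_set0 subr0 //.
apply/andP/eqP => [[/forallP col _]|->].
  by apply/ffunP=> x; rewrite ffunE; apply/eqP; have := col x; rewrite inE.
by split; apply/forallP=> x; rewrite !ffunE ?eqxx ?implybT.
Qed.

End SchurValues.

(** * Virtual characters *)

(** The strict rearrangement inequality, from the positivity of the sum of (i - s i)^2. *)
Lemma perm_moment M (s : {perm 'I_M}) : s != 1%g ->
  \sum_(i < M) (i : nat)%:Z * (s i : nat)%:Z < \sum_(i < M) (i : nat)%:Z * (i : nat)%:Z.
Proof.
move=> s_neq1; have [i0 ne_i0] : exists i, s i != i.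
  apply/existsP; rewrite -[[exists _, _]]negbK negb_exists; apply/negP=> /forallP fix_s.
  by case/eqP: s_neq1; apply/permP=> i; rewrite perm1; apply/eqP; rewrite -[_ == _]negbK.
have sq : 0 < \sum_(i < M) ((i : nat)%:Z - (s i : nat)%:Z) ^+ 2.
  rewrite (bigD1 i0) //= ltr_wpDr ?sumr_ge0 // => [i _|]; first exact: sqr_ge0.
  by rewrite lt_neqAle sqr_ge0 andbT eq_sym sqrf_eq0 subr_eq0 eqz_nat eq_sym.
have sqE : \sum_(i < M) ((i : nat)%:Z - (s i : nat)%:Z) ^+ 2 =
    (\sum_(i < M) (i : nat)%:Z * (i : nat)%:Z - \sum_(i < M) (i : nat)%:Z * (s i : nat)%:Z) *+ 2.
  under eq_bigr do rewrite sqrrB.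
  rewrite big_split sumrB /= sumrMnl.
  rewrite -(reindex_inj (P := xpredT) (F := fun i : 'I_M => (i : nat)%:Z ^+ 2) (@perm_inj _ s)) /=.
  under [in LHS]eq_bigr do rewrite expr2.
  by rewrite mulrnBl mulr2n addrAC.
by move: sq; rewrite sqE pmulrn_lgt0 // subr_gt0.
Qed.

Section SchurCharacters.
Variables (T : finType) (N : nat) (A : {set T}) (G : {group {perm T}}).
Hypothesis GA : G :=: Sym A.
Implicit Types (h : {ffun T -> 'I_N.+1}) (g : {perm T}) (nu mu : ivec N.+1).

Local Notation col h := (colouring ord0 A h).

Fact stab_col_group_set h : group_set [set g in G | recolour h g == h].
Proof.
apply/group_setP; split=> [|x y]; first by rewrite inE group1 recolour1 eqxx.
rewrite !inE => /andP[Gx /eqP hx] /andP[Gy /eqP hy].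
by rewrite groupM // recolourM hy hx eqxx.
Qed.
Fact stab_col_key h : {S : {group {perm T}} | S :=: [set g in G | recolour h g == h]}.
Proof. by exists (Group (stab_col_group_set h)). Qed.
Definition stab_col h := sval (stab_col_key h).

Lemma in_stab_col h g : (g \in stab_col h) = (g \in G) && (recolour h g == h).
Proof. by rewrite (svalP (stab_col_key h)) inE. Qed.

Lemma stab_col_sub h : stab_col h \subset G.
Proof. by apply/subsetP=> g; rewrite in_stab_col => /andP[]. Qed.

(** For a colouring [h] of [A] this is a Young permutation character, corresponding to a product of
    complete homogeneous functions. *)
Definition col_char h : 'CF(G) := 'Ind[G] (1 : 'CF(stab_col h)).

Lemma card_transporter h0 h p : p \in G -> recolour h0 p = h ->
  (\sum_(g in G) (recolour h0 g == h) = #|stab_col h0|)%N.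
Proof.
move=> Gp <-; rewrite (reindex_inj (mulgI p)) /= -sum1_card.
rewrite [LHS]big_mkcond [RHS]big_mkcond; apply: eq_bigr => g _.
rewrite in_stab_col groupMl //; case: (g \in G) => //=; rewrite recolourM.
have -> : (recolour (recolour h0 g) p == recolour h0 p) = (recolour h0 g == h0).
  apply/eqP/eqP => [eq_h|-> //].
  by rewrite -[LHS](recolour1) -[RHS]recolour1 -(mulVg p) !(recolourM _ p^-1) eq_h.
by case: eqP.
Qed.

(** The formula for induced characters counts the y in [G] such that [g] fixes [recolour h0 y]; each
    colouring with the content of [h0] is hit by exactly [#|stab_col h0|] of them. *)
Lemma col_charE h0 g : col h0 -> g \in G ->
  col_char h0 g =
  (\sum_(h | col h && (content A h == content A h0)) invariant_col g h)%N%:R.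
Proof.
move=> col0 Gg; rewrite /col_char cfIndE ?stab_col_sub //.
apply: (canLR (mulKf _)); first by rewrite pnatr_eq0 -lt0n cardG_gt0.
rewrite -natrM big_distrr /=.
transitivity ((\sum_(y in G) invariant_col g (recolour h0 y))%N%:R : algC).
  rewrite natr_sum; apply: eq_bigr => y Gy; rewrite cfun1E in_stab_col groupJ //=; congr (_%:R).
  rewrite conjgE invariant_colE recolourM recolourM; congr nat_of_bool.
  apply/eqP/eqP => [eq_h|->]; last by rewrite -recolourM mulVg recolour1.
  by rewrite -{2}eq_h -[RHS]recolourM mulgV recolour1.
congr (_%:R); rewrite (partition_big (recolour h0) (fun h => col h && (content A h == content A h0))) /=; last first.
  by move=> y; rewrite GA => Ay; rewrite colouring_recolour // content_recolour // col0 eqxx.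
apply: eq_bigr => h /andP[colh /eqP ch].
have [p Ap hp] := colouring_transitive colh col0 ch; rewrite -GA in Ap.
rewrite -(card_transporter Ap hp) big_distrl /= [RHS]big_mkcond [LHS]big_mkcond /=.
rewrite [RHS]big_mkcond [LHS]big_mkcond; apply: eq_bigr => y _.
by case: (y \in G) => //=; case: eqP => [->|]; rewrite ?mul1n ?mul0n.
Qed.

(* One colouring for each content, so that [schur_cf] counts each permutation *)
(* character [col_char] once.                                                 *)
Definition canon h : {ffun T -> 'I_N.+1} :=
  choose (fun h' => col h' && (content A h' == content A h)) h.

Lemma canonP h : col h -> col (canon h) /\ content A (canon h) = content A h.
Proof.
move=> colh; rewrite /canon; set P := fun _ => _.
by have /andP[? /eqP] : P (choose P h) by apply: chooseP; rewrite /P colh eqxx.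
Qed.

Lemma canon_content h h' : col h -> col h' -> content A h = content A h' -> canon h = canon h'.
Proof.
move=> colh colh' eqc; rewrite /canon (eq_choose (Q := fun h1 => col h1 && (content A h1 == content A h'))).
  by apply: choose_id; rewrite ?colh ?colh' ?eqc eqxx.
by move=> h1 /=; rewrite eqc.
Qed.

Lemma canon_idem h : col h -> canon (canon h) = canon h.
Proof. by move=> colh; have [c1 c2] := canonP colh; apply: canon_content. Qed.

(** The Jacobi-Trudi expansion in permutation characters, which exhibits [schur_val] as the values
    of a virtual character. *)
Definition schur_cf nu : 'CF(G) :=
  \sum_(h | col h && (canon h == h))
    (match_det (nu - icontent A h) (staircase N.+1))%:~R *: col_char h.

Lemma schur_cfE nu g : g \in G -> schur_cf nu g = (schur_val A nu g)%:~R.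
Proof.
move=> Gg; rewrite sum_cfunE /schur_val.
rewrite [X in _ = X%:~R](partition_big canon (fun h => col h && (canon h == h))) /=; last first.
  by move=> h /andP[colh _]; rewrite canon_idem // eqxx; case: (canonP colh) => ->.
rewrite rmorph_sum /=; apply: eq_bigr => h0 /andP[col0 /eqP can0].
rewrite cfunE col_charE // natr_sum mulr_sumr [RHS]rmorph_sum /=.
rewrite [LHS]big_mkcond [RHS]big_mkcond; apply: eq_bigr => h _ /=.
have [colh|] //= := boolP (col h).
have [eqc|nec] := eqVneq (content A h) (content A h0).
  rewrite (canon_content colh col0 eqc) can0 eqxx andbT.
  have -> : icontent A h = icontent A h0 by rewrite /icontent eqc.
  by case: invariant_col; rewrite ?mulr1 ?mulr0.
case: eqP => [eqh|_]; last by rewrite andbF.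
by case/eqP: nec; rewrite -eqh; case: (canonP colh).
Qed.

Lemma schur_cf_vchar nu : schur_cf nu \in 'Z[irr G]%g.
Proof.
apply: rpred_sum => h _; rewrite scaler_int rpredMz //.
by apply: char_vchar; rewrite cfInd_char ?cfun1_char.
Qed.

Lemma schur_cf_dot nu mu :
  (forall i, 0 <= mu i) -> \sum_i mu i = #|A|%:Z + 'C(N.+1, 2)%:Z ->
  '[schur_cf nu, schur_cf mu] = (match_det nu mu)%:~R.
Proof.
move=> mu_ge0 sum_mu; rewrite cfdotE.
apply: (canLR (mulKf _)); first by rewrite pnatr_eq0 -lt0n cardG_gt0.
transitivity ((#|Sym A|%:Z * match_det nu mu)%:~R : algC); last by rewrite intrM -GA.
rewrite -sum_schur_val_mul // rmorph_sum; apply: eq_big => [g|g Gg]; first by rewrite GA.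
by rewrite !schur_cfE // rmorph_int -intrM.
Qed.

Definition moment h : nat := (\sum_(i < N.+1) i * content A h i)%N.

Lemma moment_le h : (moment h <= N * #|A|)%N.
Proof.
rewrite -(sum_content A h) big_distrr /=; apply: leq_sum => i _.
by rewrite leq_mul2r -ltnS ltn_ord orbT.
Qed.

(* Unitriangularity of the transition from Schur functions to complete        *)
(* homogeneous functions, with respect to the moments of the contents.        *)
Lemma cfdot_col_char phi : (forall nu, '[phi, schur_cf nu] = 0) ->
  forall h, col h -> '[phi, col_char h] = 0.
Proof.
move=> orth h; move: {2}(N * #|A| - moment h)%N (leqnn (N * #|A| - moment h)) => n.
elim/ltn_ind: n h => n IHn h le_n colh.
have [colc contc] := canonP colh.
have charc : col_char (canon h) = col_char h.
  by apply/cfun_inP=> g Gg; rewrite !col_charE // contc.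
have := orth (icontent A h + staircase N.+1).
rewrite cfdot_sumr (bigD1 (canon h)) /=; last by rewrite canon_idem // colc eqxx.
have -> : icontent A (canon h) = icontent A h by rewrite /icontent contc.
rewrite addrAC subrr add0r match_det_refl; last exact: staircase_inj.
rewrite scale1r charc big1 ?addr0 // => h' /andP[/andP[colh' /eqP canh'] ne_h'].
have [->|/match_det_neq0[s eq_s]] := eqVneq (match_det (icontent A h + staircase N.+1 - icontent A h') (staircase N.+1)) 0.
  by rewrite scale0r cfdot0r.
have eq_i i : (content A h' i)%:Z = (content A h i)%:Z + (i : nat)%:Z - (s i : nat)%:Z.
  have := congr1 (fun v : ivec N.+1 => v i) eq_s; rewrite !ivecE [RHS]ffunE.
  rewrite [icontent A h i]ffunE [icontent A h' i]ffunE [staircase _ i]ffunE [staircase _ (s i)]ffunE.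
  by lia.
have [s1|/perm_moment s_neq1] := eqVneq s 1%g.
  case/eqP: ne_h'; rewrite -canh'; apply: canon_content => //; apply/ffunP=> i.
  by apply/eqP; rewrite -eqz_nat eq_i s1 perm1 addrK.
suff lt_mom : (moment h < moment h')%N.
  have := IHn (N * #|A| - moment h')%N _ h' (leqnn _) colh'.
  rewrite cfdotZr => ->; first by rewrite mulr0.
  by have := moment_le h'; lia.
rewrite -ltz_nat /moment !(big_morph Posz PoszD (erefl _)).
have -> : \sum_(i < N.+1) (i * content A h' i)%N%:Z = \sum_(i < N.+1) (i * content A h i)%N%:Z
    + (\sum_(i < N.+1) (i : nat)%:Z * (i : nat)%:Z - \sum_(i < N.+1) (i : nat)%:Z * (s i : nat)%:Z).
  rewrite -sumrB -big_split; apply: eq_bigr => i _ /=.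
  by rewrite !PoszM eq_i; ring.
by rewrite ltrDl subr_gt0.
Qed.

(** With at least [#|A|] colours available, some colouring is injective on [A]. Its permutation
    character vanishes off the identity, so the scalar product with it detects [phi 1]. *)
Lemma cfun1_eq0 phi : (#|A| <= N.+1)%N -> (forall nu, '[phi, schur_cf nu] = 0) -> phi 1%g = 0.
Proof.
move=> le_A orth.
have sum_m : (\sum_(i < N.+1) (i < #|A|)%N)%N = #|A|.
  by rewrite -big_mkcond -(big_ord_widen N.+1 (fun=> 1%N)) // sum1_card card_ord.
have [h [colh contE]] := content_exists (ord0 : 'I_N.+1) sum_m.
have injh h' : content A h' = content A h -> {in A &, injective h'}.
  move=> eqc x y xA yA eq_xy; apply/eqP; apply: contraT => ne_xy.
  have: (1 < content A h' (h' x))%N.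
    rewrite ffunE (bigD1 x) //= eqxx (bigD1 y) /=; last by rewrite yA eq_sym.
    by rewrite eq_xy eqxx addnA leq_addr.
  by rewrite eqc contE ltnNge leq_b1.
have char_neq1 g : g \in G -> g != 1%g -> col_char h g = 0.
  move=> Gg neq1; rewrite col_charE // big1 // => h' /andP[_ /eqP eqc].
  apply/eqP; rewrite eqb0; apply: contra neq1 => /forallP inv.
  apply/eqP/permP=> x; rewrite perm1; have Ag : g \in Sym A by rewrite -GA.
  have [xA|xA] := boolP (x \in A); last by move: Ag; rewrite inE => /out_perm->.
  by apply: (injh h' eqc); rewrite ?(Sym_closed x Ag) //; apply/eqP.
have := cfdot_col_char orth colh; rewrite cfdotE (bigD1 1%g) //= big1 => [|g /andP[Gg neq1]]; last first.
  by rewrite char_neq1 // conjC0 mulr0.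
rewrite addr0 => /eqP; rewrite !mulf_eq0 invr_eq0 pnatr_eq0 -leqn0 leqNgt cardG_gt0 /=.
rewrite conjC_eq0 => /orP[/eqP-> //|].
rewrite col_charE // (bigD1 h) /=; last by rewrite colh eqxx.
rewrite (_ : invariant_col 1 h) ?pnatr_eq0 //.
by apply/forallP=> x; rewrite perm1.
Qed.

Lemma irr_schur_cf (i : Iirr G) : (#|A| <= N.+1)%N -> ~ forall nu, '['chi_i, schur_cf nu] = 0.
Proof.
by move=> le_A /(cfun1_eq0 le_A) /eqP; rewrite (negPf (irr1_neq0 i)).
Qed.

End SchurCharacters.

(** * Beta-sets *)

(* Removing a rim hook of length [q] from a partition slides some bead        *)
(* [c + q] of its beta-set down to the vacant position [c].                   *)
Definition slide (q c : nat) (X : {fset nat}) : {fset nat} := c |` (X `\ (c + q)%N).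

Definition slidable (q : nat) (X : {fset nat}) (c : nat) : bool :=
  ((c + q)%N \in X) && (c \notin X).

Definition bead_sum (X : {fset nat}) : nat := \sum_(x <- X) x.

Lemma bead_sum_ge X : ('C(#|` X|, 2) <= bead_sum X)%N.
Proof. exact/sum_uniq_ge/fset_uniq. Qed.

Lemma bead_sumU1 x X : x \notin X -> bead_sum (x |` X) = (x + bead_sum X)%N.
Proof. exact: big_fsetU1. Qed.

Lemma bead_sumD1 x X : x \in X -> bead_sum X = (x + bead_sum (X `\ x))%N.
Proof. exact: big_fsetD1. Qed.

(* [X] is the beta-set, with [M] beads, of a partition of [n].                *)
Definition beta_set (M n : nat) (X : {fset nat}) : bool :=
  (#|` X| == M) && (bead_sum X == n + 'C(M, 2))%N.

Definition bead_vec (M : nat) (X : {fset nat}) : ivec M := [ffun i : 'I_M => (nth 0%N X i)%:Z].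

Lemma in_slide q c X (x : nat) : (x \in slide q c X) = (x == c)%N || (x != c + q)%N && (x \in X).
Proof. by rewrite !inE. Qed.

Lemma slide_size q c X : slidable q X c -> #|` slide q c X| = #|` X|.
Proof.
case/andP=> cqX cX; rewrite cardfsU1 [in RHS](cardfsD1 (c + q)%N X) cqX.
by rewrite !inE (negPf cX) andbF.
Qed.

Lemma slide_sum q c X : slidable q X c -> (bead_sum (slide q c X) + q = bead_sum X)%N.
Proof.
case/andP=> cqX cX; rewrite bead_sumU1; last by rewrite !inE (negPf cX) andbF.
by rewrite [RHS](bead_sumD1 cqX) addnAC.
Qed.

Lemma slide_beta_set M n q c X : beta_set M n X -> slidable q X c ->
  (q <= n)%N /\ beta_set M (n - q) (slide q c X).
Proof.
case/andP=> /eqP sz /eqP sum_X sl; have sum_s := slide_sum sl.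
have szs := slide_size sl.
have min_s : ('C(M, 2) <= bead_sum (slide q c X))%N.
  by rewrite -sz -szs; apply: bead_sum_ge.
have le_q : (q <= n)%N by move: sum_s min_s; rewrite sum_X; lia.
split=> //; rewrite /beta_set szs sz eqxx /=; apply/eqP.
by move: sum_s min_s; rewrite sum_X; lia.
Qed.

(** With [x] added there are M + 1 distinct naturals, whose sum is at least ['C(M.+1, 2)]. *)
Lemma beta_set_vacant M n X x : beta_set M n X -> x \notin X -> (M <= x + n)%N.
Proof.
case/andP=> /eqP sz /eqP sum_X xX.
have := bead_sum_ge (x |` X); rewrite cardfsU1 xX sz bead_sumU1 //.
by rewrite sum_X add1n bin2_succ; lia.
Qed.

Lemma beta_set_bead M n X x : beta_set M n X -> x \in X -> (x < M + n)%N.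
Proof.
case/andP=> /eqP sz /eqP sum_X xX; move: sz sum_X; rewrite (cardfsD1 x) xX add1n => <-.
have := bead_sum_ge (X `\ x).
by rewrite (bead_sumD1 xX) bin2_succ; lia.
Qed.

Section BeadVectors.
Variable M : nat.
Implicit Types (X Y : {fset nat}) (nu : ivec M).

Local Notation vec := (bead_vec M).

Lemma bead_vec_ge0 X i : 0 <= vec X i.
Proof. by rewrite ffunE. Qed.

Lemma bead_vec_inj X : #|` X| = M -> injective (vec X).
Proof.
move=> sz i j; rewrite !ffunE => -[/eqP]; rewrite nth_uniq ?sz ?fset_uniq //.
by move/eqP/val_inj.
Qed.

Lemma bead_vecP X c : #|` X| = M -> reflect (exists i, vec X i = c%:Z) (c \in X).
Proof.
move=> sz; apply: (iffP idP) => [cX|[i]]; last first.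
  by rewrite ffunE => -[<-]; rewrite mem_nth ?sz.
have lt_c : (index c X < M)%N by rewrite -sz index_mem.
by exists (Ordinal lt_c); rewrite ffunE /= nth_index.
Qed.

Lemma sum_bead_vec n X : beta_set M n X -> \sum_i vec X i = n%:Z + 'C(M, 2)%:Z.
Proof.
case/andP=> /eqP sz /eqP sum_X; rewrite -PoszD -sum_X /bead_sum (big_nth 0%N) sz big_mkord.
by rewrite (big_morph Posz PoszD (erefl _)); apply: eq_bigr => i _; rewrite ffunE.
Qed.

Lemma match_det_bead_vec X Y : #|` X| = M -> #|` Y| = M ->
  match_det (vec X) (vec Y) = (X == Y)%:Z.
Proof.
move=> szX szY; have [->|neq] := eqVneq X Y; first exact/match_det_refl/bead_vec_inj.
apply/eqP; apply: contraNT neq => /match_det_neq0[s eq_s].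
rewrite eqEfcard szX szY leqnn andbT; apply/fsubsetP=> x /(bead_vecP _ szX)[i eq_i].
by apply/(bead_vecP _ szY); exists (s i); rewrite -eq_i eq_s [RHS]ffunE.
Qed.

Lemma bead_vec_surj nu : injective nu -> (forall i, 0 <= nu i) ->
  exists2 X, #|` X| = M & exists s : {perm 'I_M}, nu = [ffun i => vec X (s i)].
Proof.
move=> inj_nu nu_ge0; pose X : {fset nat} := [fset `|nu i|%N | i in 'I_M].
have szX : #|` X| = M.
  rewrite card_in_imfset /= ?size_enum_ord -?cardE ?card_ord // => i j _ _ eq_ij; apply: inj_nu.
  by rewrite -(gez0_abs (nu_ge0 i)) -(gez0_abs (nu_ge0 j)) eq_ij.
exists X => //; apply: ivec_perm => // i.
have /(bead_vecP _ szX)[j eq_j] : `|nu i|%N \in X by apply/imfsetP; exists i.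
by exists j; rewrite eq_j gez0_abs.
Qed.

(** [F] kills the lowered vectors that become negative or hit another bead; every other one lists a
    slid bead set, in an order that [F] does not see. *)
Lemma fermionic_bead_vec (V : zmodType) (F : ivec M -> V) q X :
  (0 < q)%N -> fermionic F -> #|` X| = M ->
  down q F (vec X) =
  \sum_(c <- X | (q <= c)%N && slidable q X (c - q)) F (vec (slide q (c - q) X)).
Proof.
move=> q_gt0 [Fsym Fni Fneg] sz; rewrite (big_nth 0%N) sz big_mkord [RHS]big_mkcond /down.
apply: eq_bigr => i _; have ci : nth 0%N X i \in X by rewrite mem_nth ?sz.
have vi : vec X i = (nth 0%N X i)%:Z by rewrite ffunE.
set c := nth _ _ _ in ci vi *; rewrite /slidable.
have [le_qc|lt_cq] /= := leqP q c; last first.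
  by apply: (Fneg _ i); rewrite !ivecE eqxx vi; lia.
rewrite subnK // ci /=.
have [/(bead_vecP _ sz)[j vj]|cqX] /= := boolP ((c - q)%N \in X).
  apply: Fni; apply/injectivePn; exists i, j.
    by apply/eqP=> eq_ij; move: vj; rewrite -eq_ij vi; lia.
  rewrite !ivecE eqxx vi vj; case: (j =P i) => [eq_ij|_]; last by lia.
  by move: vj; rewrite eq_ij vi; lia.
have sl : slidable q X (c - q) by rewrite /slidable subnK ?ci.
have szs : #|` slide q (c - q) X| = M by rewrite slide_size.
have [||s ->] := @ivec_perm _ (vec X - spike q i) (vec (slide q (c - q) X)); last by rewrite Fsym.
  have aux k : vec X k = (c - q)%N%:Z -> False.
    by move=> vk; case/negP: cqX; apply/(bead_vecP _ sz); exists k.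
  move=> k l; rewrite !ivecE; case: (k =P i) => [->|nk]; case: (l =P i) => [->|nl] //.
  - by rewrite vi => eq_l; case: (aux l); lia.
  - by rewrite vi => eq_l; case: (aux k); lia.
  by rewrite !subr0; apply: bead_vec_inj.
move=> k; case: (k =P i) => [->|nk].
  have /(bead_vecP _ szs)[j vj] : (c - q)%N \in slide q (c - q) X by rewrite in_slide eqxx.
  by exists j; rewrite !ivecE eqxx vi vj; lia.
have /(bead_vecP _ szs)[j vj] : nth 0%N X k \in slide q (c - q) X.
  rewrite in_slide subnK // mem_nth ?sz // andbT nth_uniq ?sz ?fset_uniq //.
  by rewrite (introN eqP) ?orbT // => /val_inj.
by exists j; rewrite !ivecE (introF eqP nk) subr0 vj ffunE.
Qed.

(** * Degrees modulo 2 *)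

Lemma F2_char2 (x : 'F_2) : x + x = 0.
Proof. by apply/eqP; rewrite -mulr2n -mulr_natr pchar_Fp_0 ?mulr0. Qed.

Lemma F2_cases (x : 'F_2) : x = (x != 0)%:R.
Proof. by case: x => -[|[|//]] lt; apply/val_inj. Qed.

Lemma fermionic_match_det (mu : ivec M) : (forall i, 0 <= mu i) ->
  fermionic (fun nu : ivec M => (match_det nu mu)%:~R : 'F_2).
Proof.
move=> mu_ge0; split=> [nu s|nu|nu i].
- rewrite match_det_perml intrM; case: (odd_perm s); rewrite ?mul1r //.
  by rewrite expr1 rmorphN1 mulN1r; apply/eqP; rewrite eq_sym -addr_eq0 F2_char2.
- by move/match_det_noninj->.
by move/match_det_neg->.
Qed.

(* The degree, modulo 2, of the virtual character with beta-numbers [nu].     *)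
Definition degree2 (n : nat) : ivec M -> 'F_2 :=
  iter n (down 1) (fun nu => (match_det nu (staircase M))%:~R).

Definition odd_beta (n : nat) (X : {fset nat}) : bool :=
  beta_set M n X && (degree2 n (vec X) != 0).

Lemma fermionic_degree2 n : fermionic (degree2 n).
Proof. exact/fermionic_iter_down/fermionic_match_det/staircase_ge0/F2_char2. Qed.

(** The outermost [2 ^ k] lowerings by 1 merge into a single lowering by [2 ^ k]; the remaining n
    give the degree parity of each slid bead set. *)
Lemma degree2_slide n k X : beta_set M (n + 2 ^ k) X ->
  degree2 (n + 2 ^ k) (vec X) =
  (\sum_(c <- X | (2 ^ k <= c) && slidable (2 ^ k) X (c - 2 ^ k))
     odd_beta n (slide (2 ^ k) (c - 2 ^ k) X))%N%:R.
Proof.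
move=> bX; rewrite /degree2 addnC iterD iter_down1_pow2; last exact: F2_char2.
rewrite fermionic_bead_vec ?expn_gt0 //; last by case/andP: bX => /eqP.
  rewrite natr_sum; apply: eq_bigr => c /andP[_ sl]; rewrite [LHS]F2_cases /odd_beta.
  by have [_] := slide_beta_set bX sl; rewrite addnK => ->.
exact: fermionic_degree2.
Qed.

Lemma odd_betaE n k X : beta_set M (n + 2 ^ k) X ->
  odd_beta (n + 2 ^ k) X =
  odd (\sum_(c <- X | (2 ^ k <= c) && slidable (2 ^ k) X (c - 2 ^ k))
     odd_beta n (slide (2 ^ k) (c - 2 ^ k) X))%N.
Proof.
move=> bX; rewrite /odd_beta bX degree2_slide //=; set r := (\sum_(c <- _ | _) _)%N.
by rewrite -(dvdn_pcharf (pchar_Fp (isT : prime 2))) dvdn2 negbK.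
Qed.

Lemma odd_beta0 X : beta_set M 0 X -> odd_beta 0 X.
Proof.
move=> bX; rewrite /odd_beta bX /degree2 /=.
have /andP[/eqP sz _] := bX.
have [s eq_s] := nonneg_inj_min (bead_vec_inj sz) (bead_vec_ge0 X) (sum_bead_vec bX).
rewrite eq_s match_det_perml match_det_refl ?mulr1; last exact: staircase_inj.
by case: odd_perm.
Qed.

End BeadVectors.

(** * Sliding beads *)

Local Open Scope nat_scope.

Lemma eq_beads (X Y : {fset nat}) : (forall x : nat, (x \in X) = (x \in Y)) -> X = Y.
Proof. by move=> eqXY; apply/fsetP. Qed.

Lemma mem_at (X : {fset nat}) (t x : nat) : t \in X -> (x == t) ==> (x \in X).
Proof. by move=> tX; apply/implyP=> /eqP->. Qed.

Lemma notin_at (X : {fset nat}) (t x : nat) : t \notin X -> (x == t) ==> (x \notin X).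
Proof. by move=> tX; apply/implyP=> /eqP->. Qed.

(** Specializes all membership hypotheses to the point [x], which reduces equality of bead sets to a
    goal for [lia]. *)
Ltac at_point x := repeat match goal with
  | H : is_true (?t \in ?X) |- _ => generalize (mem_at x H); generalize H; clear H
  | H : is_true (?t \notin ?X) |- _ => generalize (notin_at x H); generalize H; clear H
  end.

Ltac slide_eq := apply: eq_beads; let x := fresh "x" in move=> x; rewrite !in_slide; at_point x; lia.

Section BeadCombinatorics.
Variable M : nat.
Implicit Types (X Y Z : {fset nat}) (n k q K b c d e : nat).

Lemma slide_inj q X c d : slidable q X c -> slidable q X d ->
  slide q c X = slide q d X -> c = d.
Proof.
move=> /andP[cqX cX] /andP[dqX dX] /fsetP/(_ c).
by rewrite !in_slide eqxx (negPf cX) !andbF !orbF => /esym/eqP.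
Qed.

Lemma beta_set_core n h X c : beta_set M n X -> n < h -> ~~ slidable h X c.
Proof.
by move=> bX lt_nh; apply/negP=> /(slide_beta_set bX)[]; rewrite leqNgt lt_nh.
Qed.

(** A second K-slide would survive the first one, whose remainder n - K is smaller than K. *)
Lemma slidable_unique n K X b c : beta_set M n X -> n < K + K ->
  slidable K X b -> slidable K X c -> b = c.
Proof.
move=> bX lt_n slb slc; have [_ bX'] := slide_beta_set bX slb.
apply/eqP; apply: contraT => neq; have /negP[] := @beta_set_core _ K _ c bX' ltac:(lia).
by move: slb slc; rewrite /slidable !in_slide => /andP[s1 s2] /andP[s3 s4]; lia.
Qed.

Lemma odd_beta_beta_set n X : odd_beta M n X -> beta_set M n X.
Proof. by case/andP. Qed.

Lemma odd_beta_slide n k X : odd_beta M (n + 2 ^ k) X ->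
  exists2 c, slidable (2 ^ k) X c & odd_beta M n (slide (2 ^ k) c X).
Proof.
move=> oX; move: (oX); rewrite odd_betaE ?odd_beta_beta_set // => odd_sum.
have [/hasP[c cX /and3P[le_c sl oc]]|/hasPn none] := boolP (has (fun c =>
    [&& 2 ^ k <= c, slidable (2 ^ k) X (c - 2 ^ k) & odd_beta M n (slide (2 ^ k) (c - 2 ^ k) X)]) X).
  by exists (c - 2 ^ k).
move: odd_sum; rewrite big_seq_cond big1 // => c /and3P[cX le_c sl].
by have := none c cX; rewrite le_c sl /= => /negPf->.
Qed.

Lemma sum_slidable_uniq q X (s : seq nat) (F : nat -> nat) : uniq s ->
  (forall c, c \in s -> slidable q X c) -> (forall c, slidable q X c -> c \in s) ->
  \sum_(c <- X | (q <= c) && slidable q X (c - q)) F (c - q) = \sum_(c <- s) F c.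
Proof.
move=> us s_sl sl_s.
rewrite -(big_filter X) -(big_map (fun c => c - q) xpredT F); apply: perm_big.
apply: uniq_perm => // [|c].
  rewrite map_inj_in_uniq ?filter_uniq ?fset_uniq // => a b.
  by rewrite !mem_filter => /andP[/andP[la _] _] /andP[/andP[lb _] _]; lia.
apply/mapP/idP => [[a]|cs].
  by rewrite mem_filter => /andP[/andP[le_q sl] _] ->; apply: sl_s.
exists (c + q); rewrite ?addnK // mem_filter addnK leq_addl s_sl //=.
by have /andP[] := s_sl c cs.
Qed.

Lemma odd_beta_slide1 n k X c : beta_set M (n + 2 ^ k) X -> slidable (2 ^ k) X c ->
  (forall d, slidable (2 ^ k) X d -> d = c) ->
  odd_beta M (n + 2 ^ k) X = odd_beta M n (slide (2 ^ k) c X).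
Proof.
move=> bX sl only; rewrite odd_betaE //.
rewrite (@sum_slidable_uniq _ _ [:: c] (fun d => odd_beta M n (slide (2 ^ k) d X))) ?big_seq1 ?oddb //.
  by move=> d; rewrite inE => /eqP->.
by move=> d /only->; rewrite inE.
Qed.

(** If [c] and [d] were distinct, the number of slides with odd remainder would be 2, contradicting
    the odd degree. *)
Lemma odd_beta_slide2 n k X c d : odd_beta M (n + 2 ^ k) X ->
  slidable (2 ^ k) X c -> slidable (2 ^ k) X d ->
  (forall e, slidable (2 ^ k) X e -> e = c \/ e = d) ->
  odd_beta M n (slide (2 ^ k) c X) -> odd_beta M n (slide (2 ^ k) d X) -> c = d.
Proof.
move=> oX slc sld only oc od; apply/eqP; apply: contraT => neq.
move: (oX); rewrite odd_betaE ?odd_beta_beta_set //.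
rewrite (@sum_slidable_uniq _ _ [:: c; d] (fun e => odd_beta M n (slide (2 ^ k) e X))).
- by rewrite big_cons big_seq1 oc od.
- by rewrite /= inE neq.
- by move=> e; rewrite !inE => /orP[]/eqP->.
by move=> e /only[]->; rewrite !inE eqxx ?orbT.
Qed.

Lemma odd_beta_big_slide n k X c : beta_set M (n + 2 ^ k) X -> n < 2 ^ k ->
  slidable (2 ^ k) X c -> odd_beta M (n + 2 ^ k) X = odd_beta M n (slide (2 ^ k) c X).
Proof.
move=> bX lt_n sl; apply: odd_beta_slide1 => // d sld.
by apply: (slidable_unique bX _ sld sl); rewrite ltn_add2r.
Qed.

(* How the [q]-slide to [c] is displaced to [c'] by a [K]-slide to [b].       *)
Definition commuted q K b c c' : Prop :=
  [\/ c' = c /\ c != b, c + q = b + K /\ c' + q = b | c = b /\ c' = b + K].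

Lemma commuted_inj q K X b c d c' : 0 < K -> slidable K X b -> slidable q X c -> slidable q X d ->
  commuted q K b c c' -> commuted q K b d c' -> c = d.
Proof.
move=> K_gt0 /andP[b1 b2] /andP[c1 c2] /andP[d1 d2] [][E1 E2] [][E3 E4].
- by rewrite -E1.
- by case/negP: b2; rewrite -E4 E1.
- by case/negP: c2; rewrite -E1 E4.
- by case/negP: b2; rewrite -E2 E3.
- by apply/eqP; rewrite -(eqn_add2r q) E1 E3.
- by clear -E2 E4 K_gt0; lia.
- by case/negP: d2; rewrite -E3 E2.
- by clear -E2 E4 K_gt0; lia.
- by rewrite E1 E3.
Qed.

Lemma slide_commute_down n q K X b c e : beta_set M n X -> 0 < q -> q < K -> n < K + K ->
  slidable K X b -> slidable q X c -> slidable K (slide q c X) e ->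
  exists c', [/\ slidable q (slide K b X) c',
    slide q c' (slide K b X) = slide K e (slide q c X) &
    commuted q K b c c'].
Proof.
move=> bX q_gt0 lt_qK lt_n slb slc sle.
have [le_K bX'] := slide_beta_set bX slb.
have core t : ~~ slidable (K + q) (slide K b X) t by apply: (beta_set_core _ bX'); lia.
have uniqK t : slidable K X t -> t = b by move/(slidable_unique bX lt_n slb).
case/andP: (slb) => bKX b_X; case/andP: (slc) => cqX c_X.
move: sle; rewrite /slidable !in_slide => /andP[eK e_].
clear bX bX' slb slc le_K lt_n.
(* One bead makes both moves: it falls by K + q in total, and absence of (K + q)-slides after the
   K-slide forces it to be the bead b + K. *)
have [eKc|neKc] := eqVneq (e + K) c.
  have eX : e \notin X by clear -e_ eKc; lia.
  have eKqX : e + K + q \in X by rewrite eKc.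
  have [eqb|neqb] := eqVneq (e + q) b; last first.
    have /negP[] := core e; rewrite /slidable !in_slide addnA.
    have neb : e != b by apply/eqP=> eb; case/negP: c_X; rewrite -eKc eb.
    by clear -eKqX neb neqb eX; lia.
  exists e; split.
  - by rewrite /slidable !in_slide; clear -eKc eqb eX b_X q_gt0 lt_qK; lia.
  - by subst c b; clear -cqX c_X bKX b_X eX q_gt0 lt_qK; slide_eq.
  by apply: Or32; clear -eqb eKc; lia.
have [eX|eX] := boolP (e \in X); last first.
  have eb : e = b.
    by apply: uniqK; rewrite /slidable eX andbT; clear -eK neKc; lia.
  subst e; exists c; split.
  - by rewrite /slidable !in_slide; clear -cqX c_X eK e_ neKc; lia.
  - by clear -cqX c_X bKX b_X eK e_ neKc; slide_eq.
  by apply: Or31; split=> //; clear -e_; lia.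
(* The K-slide fills the place just vacated by the q-slide; absence of (K + q)-slides then forces c
   = b. *)
have ecq : e = c + q by clear -e_ eX; lia.
subst e; have [cb|ncb] := eqVneq c b.
  subst b; exists (c + K); split.
  - by rewrite /slidable !in_slide [c + K + q]addnAC; clear -q_gt0 lt_qK eK; lia.
  - by rewrite addnAC in eK *; clear -q_gt0 lt_qK eK cqX c_X bKX; slide_eq.
  by apply: Or33.
have /negP[] := core c; rewrite /slidable !in_slide.
have -> : c + (K + q) = c + q + K by clear; lia.
have ncqb : c + q != b by apply/eqP=> E; case/negP: b_X; rewrite -E.
by clear -ncb ncqb c_X eK q_gt0 lt_qK; lia.
Qed.

(** * Adding hooks *)

Definition lift (v u : nat) (X : {fset nat}) : {fset nat} := (u + v) |` (X `\ u).

Lemma in_lift (v u : nat) X (x : nat) : (x \in lift v u X) = (x == u + v) || (x != u) && (x \in X).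
Proof. by rewrite !inE. Qed.

Lemma lift_slide (v u : nat) X : 0 < v -> u \in X -> u + v \notin X ->
  slidable v (lift v u X) u /\ slide v u (lift v u X) = X.
Proof.
move=> v_gt0 uX uvX; rewrite /slidable !in_lift; split; first by clear -v_gt0; lia.
by apply: eq_beads => x; rewrite in_slide in_lift; at_point x; lia.
Qed.

(** The converse exchange: a q-slide of [Z] and a K-hook added to its result are completed to a
    common [X], again by excluding slides by K + q. *)
Lemma slide_commute_up n q K Y Z c e : n <= M -> beta_set M (n - K) Z -> 0 < q -> q < K ->
  K + q <= n -> n < K + K ->
  slidable q Z c -> slidable K Y e -> slide K e Y = slide q c Z ->
  exists X b c', [/\ slidable K X b, slide K b X = Z, slidable q X c' & slide q c' X = Y].
Proof.
move=> le_nM bZ q_gt0 lt_qK le_Kq lt_n slc sle eqYZ.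
have [_ bZ'] := slide_beta_set bZ slc.
have core t : ~~ slidable (K + q) Z t by apply: (beta_set_core _ bZ); lia.
case/andP: (slc) => cqZ cZ; case/andP: (sle) => eKY eY.
have memY (x : nat) : (x \in Y) = (x == e + K) || (x != e) && ((x == c) || (x != c + q) && (x \in Z)).
  have /fsetP/(_ x) := eqYZ; rewrite !in_slide.
  have [->|ne] := eqVneq x e.
    by rewrite (negPf eY); clear -q_gt0 lt_qK; lia.
  have [->|neK /= <-] := eqVneq x (e + K); first by rewrite eKY.
  by rewrite ?(negPf ne) ?neK.
have eYZ : e \in slide q c Z by rewrite -eqYZ in_slide eqxx.
have eKYZ : e + K \notin slide q c Z by rewrite -eqYZ in_slide; lia.
move: eYZ eKYZ; rewrite !in_slide => eZ eKZ.
have K_gt0 : 0 < K by clear -q_gt0 lt_qK; lia.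
have [ec|nec] := eqVneq e c.
  subst e; have cqKZ : c + q + K \notin Z.
    by have := core c; rewrite /slidable cZ andbT (addnC K) addnA.
  have [sl1 sl2] := lift_slide K_gt0 cqZ cqKZ.
  exists (lift K (c + q) Z), (c + q), (c + K); split=> //.
    by rewrite /slidable !in_lift [c + K + q]addnAC; clear -eKZ q_gt0 lt_qK cqZ cZ; lia.
  apply: eq_beads => x; rewrite in_slide !in_lift memY.
  by clear -eKZ q_gt0 lt_qK cqZ cZ cqKZ; at_point x; lia.
have eZ' : e \in Z by clear -eZ nec; lia.
have [eKcq|neKcq] := eqVneq (e + K) (c + q); last first.
  have eKZ' : e + K \notin Z by clear -eKZ neKcq; lia.
  have [sl1 sl2] := lift_slide K_gt0 eZ' eKZ'.
  exists (lift K e Z), e, c; split=> //.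
    by rewrite /slidable !in_lift; clear -eZ eKZ nec neKcq cqZ cZ K_gt0 q_gt0; lia.
  apply: eq_beads => x; rewrite in_slide !in_lift memY.
  by clear -eZ eKZ nec neKcq cqZ cZ K_gt0 q_gt0; at_point x; lia.
(* Both moves involve the place e + K = c + q. Since [n <= M], the place f = e - q exists, and it
   holds a bead, as otherwise the bead c + q = f + K + q could slide to it. *)
have le_qe : q <= e.
  have eKZ' : e + K \notin slide q c Z by rewrite in_slide.
  by have := beta_set_vacant bZ' eKZ'; clear -le_nM le_Kq; lia.
have [f ef] : exists f, e = f + q by exists (e - q); rewrite subnK.
have cE : c = f + K by clear -ef eKcq; lia.
subst e c; have fZ : f \in Z.
  have := core f; rewrite /slidable negb_and negbK => /orP[|//].
  by rewrite addnA cqZ.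
have [sl1 sl2] := lift_slide K_gt0 fZ cZ.
exists (lift K f Z), f, f; split=> //.
  by rewrite /slidable !in_lift; clear -fZ eZ' cZ cqZ q_gt0 lt_qK; lia.
apply: eq_beads => x; rewrite in_slide !in_lift memY.
by clear -fZ eZ' cZ cqZ q_gt0 lt_qK; at_point x; lia.
Qed.

Lemma pow2_top n : 0 < n -> exists a r, n = r + 2 ^ a /\ r < 2 ^ a.
Proof.
move=> n_gt0; have /andP[le lt] := trunc_log_bounds (isT : 1 < 2) n_gt0.
exists (trunc_log 2 n), (n - 2 ^ trunc_log 2 n); rewrite subnK //; split=> //.
by move: lt; rewrite expnS; lia.
Qed.

(** Removing the K-hook leaves a q-core, so a q-slide must start or end at one of the two places
    where [X] differs from that core. *)
Lemma core_slide_mod n q K X b c : beta_set M (n + K) X -> n < q -> q %| K -> slidable K X b ->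
  slidable q X c -> c = b \/ c + q = b + K.
Proof.
move=> bX lt_n dv slb slc; have [_] := slide_beta_set bX slb; rewrite addnK => bX'.
have := @beta_set_core _ q _ c bX' lt_n.
case/andP: slb => b1 b2; case/andP: slc => c1 c2.
by rewrite /slidable !in_slide; lia.
Qed.

(** Strong induction on the size r + 2^a. If 2^k <= r, both slides pass to the odd remainder of size
    r, where they agree by induction, and [commuted_inj] carries this back. If r < 2^k, at most two
    slides exist, and parity forbids that both have odd remainder. *)
Lemma odd_slide_unique n k X c d : odd_beta M (n + 2 ^ k) X ->
  slidable (2 ^ k) X c -> odd_beta M n (slide (2 ^ k) c X) ->
  slidable (2 ^ k) X d -> odd_beta M n (slide (2 ^ k) d X) -> c = d.
Proof.
move sz : (n + 2 ^ k) => N; elim/ltn_ind: N n X c d sz => N IHN n X c d sz oX slc oc sld od.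
have q_gt0 : 0 < 2 ^ k by rewrite expn_gt0.
have [|a [r [eN lt_r]]] := @pow2_top N; first by lia.
have bX := odd_beta_beta_set oX.
have le_ka : k <= a.
  rewrite -ltnS -(ltn_exp2l _ _ (isT : 1 < 2)) expnS; lia.
have [eka|lt_ka] := eqVneq k a.
  by apply: (slidable_unique bX _ slc sld); rewrite eN eka ltn_add2r.
have lt_qK : 2 ^ k < 2 ^ a by rewrite ltn_exp2l // ltn_neqAle lt_ka.
rewrite eN in oX; have [b slb ob] := odd_beta_slide oX; rewrite -eN in oX.
have [le_qr|lt_rq] := leqP (2 ^ k) r.
  have step x : slidable (2 ^ k) X x -> odd_beta M n (slide (2 ^ k) x X) ->
    exists x', [/\ slidable (2 ^ k) (slide (2 ^ a) b X) x',
      odd_beta M (r - 2 ^ k) (slide (2 ^ k) x' (slide (2 ^ a) b X)) &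
      commuted (2 ^ k) (2 ^ a) b x x'].
    move=> slx; have -> : n = r - 2 ^ k + 2 ^ a by clear -sz eN le_qr; lia.
    move=> /odd_beta_slide[e sle oe].
    have lt_N : N < 2 ^ a + 2 ^ a by rewrite eN ltn_add2r.
    have [x' [slx' eqx' rel]] := slide_commute_down bX q_gt0 lt_qK lt_N slb slx sle.
    by exists x'; split=> //; rewrite eqx'.
  have [c' [slc' oc' relc]] := step c slc oc; have [d' [sld' od' reld]] := step d sld od.
  have eq_cd : c' = d'.
    have lt_rN : r < N by rewrite eN -[X in X < _]addn0 ltn_add2l expn_gt0.
    have eq_r : r - 2 ^ k + 2 ^ k = r by rewrite subnK.
    exact: (IHN r lt_rN (r - 2 ^ k) _ c' d' eq_r ob slc' oc' sld' od').
  by apply: (commuted_inj _ slb slc sld relc); rewrite ?expn_gt0 // eq_cd.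
apply/eqP; apply: contraT => ncd.
have only e : slidable (2 ^ k) X e -> e = b \/ e + 2 ^ k = b + 2 ^ a.
  by apply: (core_slide_mod (n := r)) => //; rewrite -?eN // dvdn_exp2l.
rewrite -sz in oX; case/negP: (ncd); apply/eqP; apply: (odd_beta_slide2 oX slc sld _ oc od) => e sle.
by move: (only e sle) (only c slc) (only d sld); clear -ncd; lia.
Qed.

End BeadCombinatorics.

(** * Surjectivity on beta-sets *)

Section SlideOnto.
Variable M : nat.
Implicit Types (X Y Z : {fset nat}) (n k q K b c d e : nat).

Definition slide_onto n k : Prop := forall Y, odd_beta M (n - 2 ^ k) Y ->
  exists X c, [/\ odd_beta M n X, slidable (2 ^ k) X c & slide (2 ^ k) c X = Y].

Lemma beta_set_unslide n K X b : slidable K X b -> beta_set M n (slide K b X) ->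
  beta_set M (n + K) X.
Proof.
move=> sl; rewrite /beta_set (slide_size sl) -(slide_sum sl) => /andP[-> /eqP sumX] /=.
by rewrite -(eqn_add2r K) in sumX *; apply/eqP; move: sumX; clear; lia.
Qed.

Lemma odd_beta_unslide n a X b : n < 2 ^ a -> slidable (2 ^ a) X b ->
  odd_beta M n (slide (2 ^ a) b X) -> odd_beta M (n + 2 ^ a) X.
Proof.
move=> lt_n sl oY; have bX := beta_set_unslide sl (odd_beta_beta_set oY).
by rewrite (odd_beta_big_slide bX lt_n sl).
Qed.

Lemma runner_top n X x q : beta_set M n X -> 0 < q -> x \in X ->
  exists j, x + j * q \in X /\ x + j * q + q \notin X.
Proof.
move=> bX q_gt0 xX.
have ubP j : x + j * q \in X -> j <= M + n.
  move=> /(beta_set_bead bX) lt; rewrite -ltnS; apply: leq_ltn_trans (leqW lt).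
  by rewrite (leq_trans (leq_pmulr j q_gt0)) ?leq_addl.
have exP : exists j, x + j * q \in X by exists 0; rewrite addn0.
exists (ex_maxn exP ubP); case: ex_maxnP => j jX maxj; split=> //.
by apply/negP; rewrite -addnA -mulSnr => /maxj; rewrite ltnn.
Qed.

Lemma core_vacant q X : (forall c, ~~ slidable q X c) ->
  forall x j, x \notin X -> x + j * q \notin X.
Proof.
move=> core x; elim=> [|j IHj] xX; first by rewrite addn0.
have := core (x + j * q); rewrite /slidable IHj // andbT.
by rewrite mulSnr addnA.
Qed.

Lemma odd_beta_lift_at n a h u Y : h = 2 ^ a -> n < h -> odd_beta M n Y ->
  u \in Y -> u + h \notin Y -> odd_beta M (n + h) (lift h u Y).
Proof.
move=> -> lt_n oY uY uhY; have a_gt0 : 0 < 2 ^ a by rewrite expn_gt0.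
by have [sl eqY] := lift_slide a_gt0 uY uhY; apply: odd_beta_unslide sl _; rewrite ?eqY.
Qed.

Lemma odd_beta_lift n a Y : 0 < M -> n < 2 ^ a -> odd_beta M n Y ->
  exists X b, [/\ odd_beta M (n + 2 ^ a) X, slidable (2 ^ a) X b & slide (2 ^ a) b X = Y].
Proof.
move=> M_gt0 lt_n oY; have bY := odd_beta_beta_set oY.
have a_gt0 : 0 < 2 ^ a by rewrite expn_gt0.
have [x xY] : exists x, x \in Y.
  by apply/fset0Pn; rewrite -cardfs_gt0; case/andP: bY => /eqP ->.
have [j [bX bKX]] := runner_top bY a_gt0 xY.
have [sl1 sl2] := lift_slide a_gt0 bX bKX.
exists (lift (2 ^ a) (x + j * 2 ^ a) Y), (x + j * 2 ^ a); split=> //.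
by apply: odd_beta_unslide sl1 _; rewrite ?sl2.
Qed.

Lemma odd_beta_exists n : 0 < M -> exists X, odd_beta M n X.
Proof.
move=> M_gt0; elim/ltn_ind: n => n IHn; case: (posnP n) => [->|n_gt0].
  pose X := seq_fset tt (iota 0 M).
  have eqX : perm_eq X (iota 0 M).
    by apply: (uniq_perm (fset_uniq X) (iota_uniq _ _)) => x; rewrite seq_fsetE.
  exists X; apply: odd_beta0; rewrite /beta_set (perm_size eqX) size_iota eqxx /=.
  by rewrite /bead_sum (perm_big _ eqX) -bin2_sum /index_iota subn0.
have [a [r [eq_n lt_r]]] := pow2_top n_gt0.
have lt_rn : r < n by rewrite eq_n -[X in X < _]addn0 ltn_add2l expn_gt0.
have [Y oY] := IHn r lt_rn.
by have [X [b [oX _ _]]] := odd_beta_lift M_gt0 lt_r oY; exists X; rewrite eq_n.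
Qed.

(** A target of size r - 2^k is given a 2^a-hook, pulled back at size n, and stripped of its
    2^a-hook. Conversely a target of size n - 2^k is stripped, pulled back at size r, and given a
    2^a-hook. The two exchange lemmas keep the 2^k-slide through these steps. *)
Lemma slide_onto_top n k a r : 0 < M -> n <= M -> n = r + 2 ^ a -> r < 2 ^ a -> 2 ^ k <= r ->
  slide_onto n k <-> slide_onto r k.
Proof.
move=> M_gt0 le_nM eq_n lt_r le_qr.
have q_gt0 : 0 < 2 ^ k by rewrite expn_gt0.
have lt_qK : 2 ^ k < 2 ^ a := leq_ltn_trans le_qr lt_r.
have lt_n : n < 2 ^ a + 2 ^ a by rewrite eq_n ltn_add2r.
have nq : n - 2 ^ k = r - 2 ^ k + 2 ^ a by clear -eq_n le_qr; lia.
have lt_rq : r - 2 ^ k < 2 ^ a by apply: leq_ltn_trans lt_r; apply: leq_subr.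
have nK : n - 2 ^ a = r by rewrite eq_n addnK.
split=> onto Y oY.
  have [Y1 [e [oY1 sle eqY]]] := odd_beta_lift M_gt0 lt_rq oY.
  rewrite -nq in oY1; have [X [c [oX slc eqY1]]] := onto Y1 oY1.
  rewrite eq_n in oX; have [b slb ob] := odd_beta_slide oX.
  rewrite -eqY1 in sle eqY; rewrite -eq_n in oX.
  have [c' [slc' eqc' _]] :=
    slide_commute_down (odd_beta_beta_set oX) q_gt0 lt_qK lt_n slb slc sle.
  by exists (slide (2 ^ a) b X), c'; rewrite eqc' eqY.
rewrite nq in oY; have [e sle oe] := odd_beta_slide oY.
have [Z [c [oZ slc eqZ]]] := onto _ oe.
have bZ : beta_set M (n - 2 ^ a) Z by rewrite nK odd_beta_beta_set.
have le_Kq : 2 ^ a + 2 ^ k <= n by rewrite eq_n addnC leq_add2r.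
have [X [b [c' [slb eqb slc' eqc']]]] :=
  slide_commute_up le_nM bZ q_gt0 lt_qK le_Kq lt_n slc sle (esym eqZ).
exists X, c'; split=> //; rewrite eq_n; apply: odd_beta_unslide slb _ => //.
by rewrite eqb.
Qed.

Lemma slide_onto_d0 k r : 0 < M -> r < 2 ^ k -> slide_onto (r + 2 ^ k) k.
Proof.
move=> M_gt0 lt_r Y; rewrite addnK => oY.
by have [X [b [oX sl eqY]]] := odd_beta_lift M_gt0 lt_r oY; exists X, b.
Qed.

Lemma slide_lift_twice q Y e : 0 < q -> slidable q Y e -> e + q + q \notin Y ->
  slidable (q + q) (lift q (e + q) Y) e /\
  slide (q + q) e (lift q (e + q) Y) = slide q e Y.
Proof.
move=> q_gt0 /andP[eqY eY] vac; split.
  by rewrite /slidable !in_lift; clear -q_gt0 eY eqY; lia.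
apply: eq_beads => x; rewrite [LHS]in_slide in_lift [RHS]in_slide.
by clear -eqY eY vac q_gt0; at_point x; lia.
Qed.

(** Raising once more the bead that carries the 2^k-hook of [Y] produces a 2^(k+1)-hook over the
    same core. *)
Lemma slide_onto_d1 k r : r < 2 ^ k -> slide_onto (r + 2 ^ k.+1) k.
Proof.
move=> lt_r Y; have -> : r + 2 ^ k.+1 - 2 ^ k = r + 2 ^ k.
  by rewrite expnS mul2n -addnn addnA addnK.
move=> oY; have [e sle oe] := odd_beta_slide oY.
have q_gt0 : 0 < 2 ^ k by rewrite expn_gt0.
have core := @beta_set_core _ r (2 ^ k) _ _ (odd_beta_beta_set oe) lt_r.
case/andP: (sle) => eqY eY.
have vac : e + 2 ^ k + 2 ^ k \notin Y.
  have := core (e + 2 ^ k); rewrite /slidable !in_slide.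
  by clear -q_gt0; lia.
have [sl1 sl2] := lift_slide q_gt0 eqY vac.
exists (lift (2 ^ k) (e + 2 ^ k) Y), (e + 2 ^ k); split=> //.
have [sl3 eq3] := slide_lift_twice q_gt0 sle vac.
have EK : 2 ^ k.+1 = 2 ^ k + 2 ^ k by rewrite expnS mul2n addnn.
apply: (@odd_beta_unslide _ _ _ e); rewrite EK ?eq3 //.
by rewrite (leq_trans lt_r) ?leq_addr.
Qed.

(** * The case of size 4 and the failures of surjectivity *)

Lemma mem_unslide q X c (x : nat) : slidable q X c ->
  (x \in X) = (x == c + q) || (x != c) && (x \in slide q c X).
Proof.
move=> /andP[c1 c2]; rewrite in_slide.
have [->|ne1] := eqVneq x (c + q); first by rewrite c1.
by have [->|ne2] := eqVneq x c; rewrite ?(negPf c2).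
Qed.

Lemma beta_set0_mem X (x : nat) : beta_set M 0 X -> (x \in X) = (x < M).
Proof.
move=> bX; apply/idP/idP => [/(beta_set_bead bX)|lt_x]; first by rewrite addn0.
by apply: contraTT lt_x => /(beta_set_vacant bX); rewrite addn0 -leqNgt.
Qed.

Lemma lift_raise h s t Y : 0 < h -> t \in Y -> (0 < s -> t + s \notin Y) -> t + s + h \notin Y ->
  slidable h (lift (s + h) t Y) (t + s) /\
  slide h (t + s) (lift (s + h) t Y) = lift s t Y.
Proof.
move=> h_gt0 tY tsY tshY; have [s0|s_gt0] := posnP s.
  subst s; rewrite !addn0 add0n in tshY *.
  split; first by rewrite /slidable !in_lift; clear -h_gt0; lia.
  apply: eq_beads => x; rewrite [LHS]in_slide in_lift [RHS]in_lift.
  by clear -h_gt0 tY tshY; at_point x; lia.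
have {}tsY := tsY s_gt0; split.
  by rewrite /slidable !in_lift; clear -h_gt0 tsY s_gt0; lia.
apply: eq_beads => x; rewrite [LHS]in_slide in_lift [RHS]in_lift.
by clear -h_gt0 s_gt0 tY tsY tshY; at_point x; lia.
Qed.

(** Bead [t] climbs by 2^(k+i0), 2^(k+i0+1), and so on. Each step exceeds the size reached before
    it, so each added hook preserves oddness. *)
Lemma odd_beta_raise k r i0 W t : r < 2 ^ k -> odd_beta M (r + 2 ^ k * (2 ^ i0 - 1)) W ->
  t \in W -> (forall j, 0 < j -> t + j * 2 ^ k \notin W) ->
  forall i, odd_beta M (r + 2 ^ k * (2 ^ (i0 + i) - 1)) (lift (2 ^ k * (2 ^ (i0 + i) - 2 ^ i0)) t W).
Proof.
move=> lt_r oW tW vac; elim=> [|i IHi].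
  rewrite addn0 subnn muln0 (_ : lift 0 t W = W) //.
  by apply: eq_beads => x; rewrite in_lift addn0; clear -tW; at_point x; lia.
have h_gt0 : 0 < 2 ^ (k + (i0 + i)) by rewrite expn_gt0.
have le_i0 : 2 ^ i0 <= 2 ^ (i0 + i) by rewrite leq_exp2l // leq_addr.
have i0_gt0 : 0 < 2 ^ i0 by rewrite expn_gt0.
have EK : 2 ^ (i0 + i.+1) = 2 ^ (i0 + i) + 2 ^ (i0 + i) by rewrite addnS expnS mul2n addnn.
have vac' j : 0 < j -> t + 2 ^ k * j \notin W by rewrite mulnC; apply: vac.
have [||sl eqs] := @lift_raise _ (2 ^ k * (2 ^ (i0 + i) - 2 ^ i0)) _ _ h_gt0 tW.
- by rewrite muln_gt0 => /andP[_]; apply: vac'.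
- rewrite (expnD 2 k (i0 + i)) -addnA -mulnDr; apply: vac'.
  by rewrite addn_gt0 expn_gt0 orbT.
have sE : 2 ^ k * (2 ^ (i0 + i) - 2 ^ i0) + 2 ^ (k + (i0 + i)) = 2 ^ k * (2 ^ (i0 + i.+1) - 2 ^ i0).
  by rewrite (expnD 2 k (i0 + i)) -mulnDr EK; congr (_ * _); clear -le_i0; lia.
have nE : r + 2 ^ k * (2 ^ (i0 + i) - 1) + 2 ^ (k + (i0 + i)) = r + 2 ^ k * (2 ^ (i0 + i.+1) - 1).
  rewrite (expnD 2 k (i0 + i)) -addnA -mulnDr EK; congr (_ + _ * _).
  by clear -le_i0 i0_gt0; lia.
rewrite -nE -sE; apply: odd_beta_unslide sl _; rewrite ?eqs //.
rewrite (expnD 2 k (i0 + i)) mulnBr muln1.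
have : 2 ^ k <= 2 ^ k * 2 ^ (i0 + i) by rewrite leq_pmulr ?expn_gt0.
by move: (2 ^ k * _) => P; clear -lt_r; lia.
Qed.

Lemma slide_onto_4 : 4 <= M -> slide_onto 4 0.
Proof.
move=> le_4M Y oY; rewrite -[4 - 2 ^ 0]/(1 + 2 ^ 1) in oY.
have [e sle oY1] := odd_beta_slide oY; rewrite -[1]/(0 + 2 ^ 0) in oY1.
have [f slf oY0] := odd_beta_slide oY1.
have mem0 x := beta_set0_mem x (odd_beta_beta_set oY0).
have mem1 x := mem_unslide x slf; have mem2 x := mem_unslide x sle.
have {}mem1 (x : nat) : (x \in slide (2 ^ 1) e Y) = (x == f + 1) || (x != f) && (x < M).
  by rewrite mem1 mem0.
have {}mem2 (x : nat) : (x \in Y) = (x == e + 2) || (x != e) && ((x == f + 1) || (x != f) && (x < M)).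
  by rewrite mem2 mem1.
have fM : f + 1 = M.
  have := mem0 f; have := mem0 (f + 1); rewrite !in_slide.
  by clear; lia.
(* The odd partitions of 3 are (3), for e = M, and (1,1,1), for e = M - 3; they extend to the
   4-hooks (4) and (1,1,1,1). *)
have eM : e = M \/ e + 3 = M.
  have := mem1 e; have := mem1 (e + 2); rewrite !in_slide.
  case/andP: sle; rewrite !mem2; clear -fM; lia.
have suff_X u b : u \in Y -> u + 1 \notin Y -> slidable 4 (lift 1 u Y) b ->
    exists X c, [/\ odd_beta M 4 X, slidable (2 ^ 0) X c & slide (2 ^ 0) c X = Y].
  move=> uY u1Y slb; have [slu equ] := lift_slide (isT : 0 < 1) uY u1Y.
  have bX : beta_set M (3 + 1) (lift 1 u Y).
    by apply: beta_set_unslide slu _; rewrite equ; exact: odd_beta_beta_set oY.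
  exists (lift 1 u Y), u; split=> //.
  apply: (@odd_beta_unslide 0 2 _ b) => //; apply: odd_beta0.
  by have [] := slide_beta_set bX slb.
case: eM => eM.
  apply: (suff_X (M + 2) f); rewrite ?mem2; first by clear -eM; lia.
    by clear -eM fM; lia.
  by rewrite /slidable !in_lift !mem2; clear -eM fM; lia.
have [g eg] : exists g, e = g + 1 by exists e.-1; clear -eM le_4M; lia.
apply: (suff_X g g); rewrite ?mem2; first by clear -eM eg fM; lia.
  by clear -eM fM eg; lia.
by rewrite /slidable !in_lift !mem2; clear -eM fM eg; lia.
Qed.

Lemma not_slide_onto_k0 a : 2 < a -> 2 ^ a <= M -> ~ slide_onto (2 ^ a) 0.
Proof.
move=> lt_2a le_M onto.
have le_8M : 8 <= M by apply: leq_trans le_M; rewrite -[8]/(2 ^ 3) leq_exp2l.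
have [M3 eM] : exists M3, M = M3 + 3 by exists (M - 3); clear -le_8M; lia.
have M_gt0 : 0 < M by clear -le_8M; lia.
have [Y0 oY0] := @odd_beta_exists 0 M_gt0.
have mem0 x := beta_set0_mem x (odd_beta_beta_set oY0).
(* [Y7] is the beta-set of the odd partition (3, 3, 1), which is not a hook.   *)
pose Y1 := lift 1 (M3 + 2) Y0; pose Y3 := lift 2 M Y1; pose Y7 := lift 4 M3 Y3.
have mem1 (x : nat) : (x \in Y1) = (x == M) || (x < M3 + 2).
  by rewrite in_lift mem0; clear -eM; lia.
have mem3 (x : nat) : (x \in Y3) = (x == M + 2) || (x < M3 + 2).
  by rewrite in_lift mem1; clear -eM; lia.
have mem7 (x : nat) : (x \in Y7) = [|| x == M + 2, x == M + 1, x == M3 + 1 | x < M3].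
  by rewrite in_lift mem3; clear -eM; lia.
have oY1 : odd_beta M 1 Y1.
  by apply: (@odd_beta_lift_at 0 0 1); rewrite ?mem0 //; clear -eM; lia.
have oY3 : odd_beta M 3 Y3.
  by apply: (@odd_beta_lift_at 1 1 2); rewrite ?mem1 //; clear -eM; lia.
have oY7 : odd_beta M 7 Y7.
  by apply: (@odd_beta_lift_at 3 2 4); rewrite ?mem3 //; clear -eM; lia.
have [i ai] : exists i, a = 3 + i by exists (a - 3); rewrite subnKC.
have := @odd_beta_raise 0 0 3 Y7 (M + 2) isT oY7.
rewrite mem7 eqxx => /(_ isT) raise.
have {raise} oY := raise _ i; rewrite -ai add0n !mul1n in oY.
have [|X [c [oX slc eqY]]] := onto _ (oY _).
  by move=> j j_gt0; rewrite mem7 muln1; clear -j_gt0 eM; lia.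
rewrite -[2 ^ a]add0n in oX; have [b slb ob] := odd_beta_slide oX.
have memX0 x := beta_set0_mem x (odd_beta_beta_set ob).
have memX (x : nat) : (x \in X) = (x == b + 2 ^ a) || (x != b) && (x < M).
  by rewrite (mem_unslide x slb) memX0.
(* The target has two beads above M, but the hook [X] has at most one bead at or above M, and
   sliding only lowers beads. *)
have u : M + 1 \in slide 1 c X by rewrite eqY in_lift mem7; clear; lia.
have v : M + 2 + (2 ^ a - 2 ^ 3) \in slide 1 c X by rewrite eqY in_lift eqxx.
case/andP: slc; move: u v; rewrite !in_slide !memX; clear; move: (2 ^ a) (2 ^ a - 2 ^ 3) => K s.
lia.
Qed.

(** Away from the runner of [b] modulo q, [X] and its q-slide agree with the q-core left by the
    K-hook. *)
Lemma slide_hook_runner r q K X b c t : beta_set M (r + K) X -> r < q -> q %| K ->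
  slidable K X b -> slidable q X c -> slidable q (slide q c X) t -> t = b %[mod q].
Proof.
move=> bX lt_r dv slb slc slt; apply/eqP; apply: contraT => neq.
have [_] := slide_beta_set bX slb; rewrite addnK => bX'.
have modK x : (x + K) %% q = x %% q by case/dvdnP: dv => j ->; rewrite addnC modnMDl.
have modq x : (x + q) %% q = x %% q by rewrite modnDr.
have eq_cb : c %% q = b %% q.
  have [->//|E] := core_slide_mod bX lt_r dv slb slc.
  by rewrite -(modq c) E modK.
have n1 : t != c by apply: contraNneq neq => ->; rewrite eq_cb.
have n2 : t != c + q by apply: contraNneq neq => ->; rewrite modq eq_cb.
have n3 : t + q != c by apply: contraNneq neq => E; rewrite -(modq t) E eq_cb.
have n4 : t + q != b + K by apply: contraNneq neq => E; rewrite -(modq t) E modK.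
have n5 : t != b by apply: contraNneq neq => ->.
case/negP: (@beta_set_core _ r q _ t bX' lt_r).
case/andP: slt; rewrite /slidable !in_slide.
by clear -n1 n2 n3 n4 n5; lia.
Qed.

(** Since k > 0, the runners of 0 and 1 modulo q = 2^k are distinct. The target raises one bead by q
    on the first and one by q(2^d - 2) on the second; it is odd but slidable on both, contradicting
    [slide_hook_runner]. *)
Lemma not_slide_onto_pos k d r : 0 < k -> 1 < d -> r < 2 ^ k -> r + 2 ^ (k + d) <= M ->
  ~ slide_onto (r + 2 ^ (k + d)) k.
Proof.
move=> k_gt0 d_gt1 lt_r le_M onto.
have eqk : exists q, q = 2 ^ k by exists (2 ^ k).
case: eqk => q eq_q; have q_ge2 : 1 < q.
  by rewrite eq_q -[2]/(2 ^ 1) leq_exp2l.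
have eK : 2 ^ (k + d) = 2 ^ d * q by rewrite expnD eq_q mulnC.
have d4 : 4 <= 2 ^ d by rewrite -[4]/(2 ^ 2) leq_exp2l.
have le_4q : 4 * q <= 2 ^ d * q by rewrite leq_mul2r d4 orbT.
have lt_rM : r.+1 < M by rewrite eK in le_M; clear -le_M le_4q q_ge2; lia.
have [Y0 oY0] := @odd_beta_exists r (ltn_trans (ltn0Sn r) lt_rM).
have bY0 := odd_beta_beta_set oY0.
have core x : ~~ slidable q Y0 x by apply: (beta_set_core x bY0); rewrite eq_q.
have q_gt0 : 0 < q by clear -q_ge2; lia.
have Y00 : 0 \in Y0.
  by apply: contraTT lt_rM => /(beta_set_vacant bY0); clear; lia.
have Y01 : 1 \in Y0.
  by apply: contraTT lt_rM => /(beta_set_vacant bY0); clear; lia.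
(* Beads displaced on the two runners of [0] and [1] modulo [q].              *)
have [j1 []] := runner_top bY0 q_gt0 Y00; have [j2 []] := runner_top bY0 q_gt0 Y01.
have : exists t1, t1 = 0 + j1 * q by exists (0 + j1 * q).
have : exists t2, t2 = 1 + j2 * q by exists (1 + j2 * q).
move=> [t2 et2] [t1 et1]; rewrite -et1 -et2 => t2Y t2qY t1Y t1qY.
have m1 j : (t1 + j * q) %% q = 0 by rewrite et1 add0n -mulnDl modnMl.
have m2 j : (t2 + j * q) %% q = 1.
  by rewrite et2 -addnA -mulnDl addnC modnMDl modn_small.
have neq i j : t1 + i * q != t2 + j * q.
  by apply/eqP=> /(congr1 (fun x => x %% q)); rewrite m1 m2.
have neq0 j : t1 != t2 + j * q by have := neq 0 j; rewrite mul0n addn0.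
have neq1 j : t1 + q != t2 + j * q by have := neq 1 j; rewrite mul1n.
have oY1 : odd_beta M (r + 2 ^ k * (2 ^ 1 - 1)) (lift q t1 Y0).
  by rewrite muln1 -eq_q; apply: (odd_beta_lift_at eq_q); rewrite ?eq_q // -eq_q.
have t2Y1 : t2 \in lift q t1 Y0.
  have := neq0 0; have := neq1 0; rewrite mul0n addn0 in_lift t2Y.
  by clear; lia.
have vac j : 0 < j -> t2 + j * q \notin lift q t1 Y0.
  case: j => // j _; have := core_vacant core j t2qY; rewrite -addnA -mulSn => vac.
  by rewrite in_lift (negPf vac) andbF orbF eq_sym neq1.
have vac' j : 0 < j -> t2 + j * 2 ^ k \notin lift q t1 Y0 by rewrite -eq_q; apply: vac.
have := odd_beta_raise lt_r oY1 t2Y1 vac' d.-1.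
rewrite add1n prednK ?(ltn_trans _ d_gt1) // -eq_q => oY.
have nq : r + 2 ^ (k + d) - 2 ^ k = r + q * (2 ^ d - 1).
  by rewrite eK -eq_q mulnBr muln1 mulnC addnBA // leq_pmulr // expn_gt0.
rewrite -nq in oY; have [X [c [oX slc eqY]]] := onto _ oY.
have bX := odd_beta_beta_set oX.
have [b slb _] := odd_beta_slide oX.
have dv : q %| 2 ^ (k + d) by rewrite eK dvdn_mull.
rewrite -eq_q in lt_r slc eqY.
have runner t := slide_hook_runner bX lt_r dv slb slc (t := t).
rewrite eqY in runner.
have s1 : slidable q (lift (q * (2 ^ d - 2 ^ 1)) t2 (lift q t1 Y0)) t1.
  rewrite /slidable; apply/andP; split.
    rewrite in_lift [t1 + q \in _]in_lift eqxx /= andbT.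
    by have := neq1 0; rewrite mul0n addn0 => ->; rewrite orbT.
  rewrite in_lift [t1 \in lift _ _ Y0]in_lift mulnC (negPf (neq0 _)).
  by clear -q_gt0; lia.
have s2 : slidable q (lift (q * (2 ^ d - 2 ^ 1)) t2 (lift q t1 Y0)) (t2 + (2 ^ d - 3) * q).
  have e3 : t2 + q * (2 ^ d - 2 ^ 1) = t2 + (2 ^ d - 3) * q + q.
    rewrite -addnA -mulSnr mulnC; congr (_ + _ * _); clear -d4; lia.
  have vac3 : t2 + (2 ^ d - 3) * q \notin lift q t1 Y0 by apply: vac; clear -d4; lia.
  rewrite /slidable; apply/andP; split; rewrite in_lift e3; first by rewrite eqxx.
  by rewrite (negPf vac3) andbF orbF; clear -q_gt0; lia.
have := runner _ s1; have := runner _ s2.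
have := m1 0; rewrite mul0n addn0 => ->; rewrite m2 => <-.
by [].
Qed.

(** The top digit adds 2^(a-k) to a positive quotient smaller than 2^(a-k), which leaves the
    valuation unchanged. *)
Lemma d2_top n k a r : n = r + 2 ^ a -> r < 2 ^ a -> 2 ^ k <= r -> d2 n k = d2 r k.
Proof.
move=> eq_n lt_r le_q; have lt_ka : k < a by rewrite -(ltn_exp2l _ _ (isT : 1 < 2)) (leq_ltn_trans le_q).
have q_gt0 : 0 < 2 ^ k by rewrite expn_gt0.
rewrite /d2; have -> : n %/ 2 ^ k = r %/ 2 ^ k + 2 ^ (a - k).
  by rewrite eq_n -{1}(subnK (ltnW lt_ka)) expnD addnC divnMDl // addnC.
have u_gt0 : 0 < r %/ 2 ^ k by rewrite divn_gt0.
have lt_u : r %/ 2 ^ k < 2 ^ (a - k).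
  by rewrite ltn_divLR // -expnD subnK // ltnW.
move: (r %/ 2 ^ k) (a - k) u_gt0 lt_u => u s u_gt0 lt_u.
have [w co_w eq_u] := pfactor_coprime (isT : prime 2) u_gt0.
set v := logn 2 u in eq_u *; rewrite coprime2n in co_w.
have w_gt0 : 0 < w by case: w co_w eq_u.
have lt_vs : v < s.
  by rewrite -(ltn_exp2l _ _ (isT : 1 < 2)) (leq_ltn_trans _ lt_u) // eq_u leq_pmull.
rewrite {1}eq_u -(subnK (ltnW lt_vs)) expnD -mulnDl lognM ?expn_gt0 ?addn_gt0 ?w_gt0 //.
rewrite pfactorK // logn_coprime // coprime2n oddD co_w oddX subn_eq0.
by rewrite leqNgt lt_vs.
Qed.

Lemma d2_base n k a r : n = r + 2 ^ a -> r < 2 ^ k -> k <= a -> d2 n k = a - k.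
Proof.
move=> eq_n lt_r le_ka; rewrite /d2 eq_n addnC -{1}(subnK le_ka) expnD.
by rewrite divnMDl ?expn_gt0 // divn_small // addn0 pfactorK.
Qed.

Lemma slide_ontoP n k : 2 ^ k <= n -> n <= M ->
  slide_onto n k <-> d2 n k <= (if k == 0 then 2 else 1).
Proof.
elim/ltn_ind: n => n IHn le_q le_M.
have n_gt0 : 0 < n by apply: leq_trans le_q; rewrite expn_gt0.
have M_gt0 := leq_trans n_gt0 le_M.
have [a [r [eq_n lt_r]]] := pow2_top n_gt0.
have [le_qr|lt_rq] := leqP (2 ^ k) r.
  have lt_rn : r < n by rewrite eq_n -[X in X < _]addn0 ltn_add2l expn_gt0.
  rewrite (d2_top eq_n lt_r le_qr) -(IHn r lt_rn le_qr (leq_trans (ltnW lt_rn) le_M)).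
  exact: (slide_onto_top M_gt0 le_M eq_n lt_r le_qr).
have le_ka : k <= a.
  rewrite -ltnS -(ltn_exp2l _ _ (isT : 1 < 2)); apply: leq_ltn_trans le_q _.
  by rewrite eq_n expnS mul2n -addnn ltn_add2r.
rewrite (d2_base eq_n lt_rq le_ka).
have [d ea] : exists d, a = k + d by exists (a - k); rewrite subnKC.
rewrite ea addKn; rewrite ea in eq_n; rewrite eq_n; case: d ea eq_n => [|[|d]] ea eq_n.
- rewrite addn0; split=> [_|_]; first by case: ifP.
  exact: slide_onto_d0.
- rewrite addn1; split=> [_|_]; first by case: ifP.
  exact: slide_onto_d1.
case: posnP => [k0|k_gt0]; last first.
  by split=> // onto; case: (not_slide_onto_pos k_gt0 (isT : 1 < d.+2) lt_rq _ onto); rewrite -eq_n.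
subst k; have r0 : r = 0 by clear -lt_rq; lia.
subst r; rewrite !add0n in eq_n *; case: d ea eq_n => [|d] ea eq_n.
  split=> // _; apply: slide_onto_4; by rewrite eq_n in le_M.
split=> // onto; case: (@not_slide_onto_k0 d.+3 _ _ onto) => //.
by rewrite -eq_n.
Qed.

End SlideOnto.

(** * Irreducible characters and beta-sets *)

Local Open Scope ring_scope.

Lemma dvdC2_int (z : int) : (2 %| (z%:~R : algC))%C = (z%:~R == 0 :> 'F_2).
Proof.
rewrite (@dvdC_int 2) ?intr_int // intrKfloor.
by rewrite -(dvdz_pcharf (pchar_Fp (isT : prime 2))) dvdzE.
Qed.

Lemma dvdC2_signed (b : bool) (x : algC) : (2 %| (-1) ^+ b * x)%C = (2 %| x)%C.
Proof. by case: b; rewrite ?mul1r // mulN1r rpredN. Qed.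

Section Labels.
Variables (T : finType) (N : nat) (A : {set T}) (G : {group {perm T}}).
Hypotheses (GA : G :=: Sym A) (le_A : (#|A| <= N.+1)%N).
Implicit Types (X Y : {fset nat}) (i j : Iirr G) (nu : ivec N.+1).

Local Notation vec := (bead_vec N.+1).
Local Notation chi X := (schur_cf A G (vec X)).

(** The sign, which depends on the order in which [bead_vec] lists the beads, is left open, as
    divisibility by 2 does not see it. *)
Definition irr_label i X : Prop :=
  beta_set N.+1 #|A| X /\ exists b : bool, chi X = (-1) ^+ b *: 'chi_i.

Lemma schur_cf_bead_dot X Y : beta_set N.+1 #|A| X -> beta_set N.+1 #|A| Y ->
  '[chi X, chi Y] = (X == Y)%:R.
Proof.
move=> bX bY; rewrite schur_cf_dot //; [|exact: bead_vec_ge0|exact: sum_bead_vec].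
by rewrite match_det_bead_vec //; [case/andP: bX => /eqP | case/andP: bY => /eqP].
Qed.

Lemma irr_label_exists X : beta_set N.+1 #|A| X -> exists i, irr_label i X.
Proof.
move=> bX; have [|b [i eq_i]] := vchar_norm1P (schur_cf_vchar A G (vec X)).
  by rewrite schur_cf_bead_dot // eqxx.
by exists i; split=> //; exists b.
Qed.

Lemma schur_cf_bead nu : '[schur_cf A G nu] != 0 ->
  exists2 X, beta_set N.+1 #|A| X & exists e : int, schur_cf A G nu = e%:~R *: chi X.
Proof.
move=> norm_nz.
have val_nz : exists2 g, g \in G & schur_val A nu g != 0.
  have [/exists_inP //|] := boolP [exists g in G, schur_val A nu g != 0].
  rewrite negb_exists_in => /forall_inP val0; case/eqP: norm_nz.
  rewrite (_ : schur_cf A G nu = 0) ?cfdot0l //; apply/cfun_inP=> g Gg.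
  by rewrite schur_cfE // (eqP (negbNE (val0 g Gg))) cfunE.
case: val_nz => g Gg val_nz.
have nu_ge0 (l : 'I_N.+1) : 0 <= nu l.
  by rewrite leNgt; apply: contraNN val_nz => neg; rewrite (schur_val_neg _ _ neg).
have sum_nu : \sum_i nu i = #|A|%:Z + 'C(N.+1, 2)%:Z.
  by apply/eqP; apply: contraNT val_nz => ne; rewrite (schur_val_size _ ne).
have inj_nu : injective nu.
  apply/injectiveP; apply: contraNT norm_nz => ninj.
  by rewrite schur_cf_dot // (match_det_noninj _ ninj).
have [X szX [s eq_nu]] := bead_vec_surj inj_nu nu_ge0.
have bX : beta_set N.+1 #|A| X.
  rewrite /beta_set szX eqxx /=; apply/eqP; move: sum_nu.
  rewrite eq_nu; under eq_bigr do rewrite ffunE.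
  rewrite -(reindex_inj (P := xpredT) (F := fun l : 'I_N.+1 => vec X l) (@perm_inj _ s)) /=.
  under eq_bigr do rewrite ffunE.
  rewrite -(big_morph Posz PoszD (erefl _)) -PoszD /bead_sum (big_nth 0%N) szX big_mkord.
  by case.
exists X => //; exists ((-1) ^+ s).
have dotXX := schur_cf_bead_dot bX bX; rewrite eqxx in dotXX.
have sumX := sum_bead_vec bX.
apply/eqP; rewrite -subr_eq0 -cfnorm_eq0 cfnormB !(cfdotZr, cfdotZl) dotXX.
rewrite !schur_cf_dot //; try exact: bead_vec_ge0.
rewrite eq_nu match_det_perml (match_detC (vec X)) match_det_perml match_det_refl; last first.
  by apply: bead_vec_inj.
rewrite !mulr1 !rmorphM !rmorph_int -!(intrM, intrD, intrB) intr_eq0.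
by case: (odd_perm s).
Qed.

Lemma label_exists i : exists X, irr_label i X.
Proof.
(* All beads lie below N + 1 + [#|A|], so the search for a label is finite. If it failed, ['chi_i]
   would be orthogonal to every [schur_cf]. *)
pose S : {fset nat} := seq_fset tt (iota 0 (N.+1 + #|A|)).
have [/hasP[X _ /andP[bX dotX]]|/hasPn none] := boolP (has (fun X =>
    beta_set N.+1 #|A| X && ('['chi_i, chi X] != 0)) (fpowerset S)).
  exists X; have [j [_ [b eqj]]] := irr_label_exists bX; split=> //; exists b.
  move: dotX; rewrite eqj cfdotZr cfdot_irr; case: (i =P j) => [-> //|_].
  by rewrite mulr0 eqxx.
case: (@irr_schur_cf _ _ _ _ GA i le_A) => nu.
have [/eqP|norm_nz] := boolP ('[schur_cf A G nu] == 0).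
  by move/eqP; rewrite cfnorm_eq0 => /eqP->; rewrite cfdot0r.
have [X bX [e ->]] := schur_cf_bead norm_nz; rewrite cfdotZr.
have XS : X \in fpowerset S.
  rewrite fpowersetE; apply/fsubsetP=> x xX; rewrite seq_fsetE mem_iota /=.
  exact: beta_set_bead bX xX.
by move: (none X XS); rewrite bX /= negbK => /eqP->; rewrite mulr0.
Qed.

Lemma irr_label_inj i j X : irr_label i X -> irr_label j X -> i = j.
Proof.
move=> [_ [b eq_i]] [_ [c eq_ij]]; rewrite eq_i in eq_ij; have := congr1 (fun phi => '['chi_i, phi]) eq_ij.
rewrite !cfdotZr !cfdot_irr eqxx; case: (i =P j) => // _ /eqP.
by rewrite mulr0 mulr1 fmorph_eq0 signr_eq0.
Qed.

Lemma schur_val1 nu : (schur_val A nu 1%g)%:~R = degree2 #|A| nu.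
Proof.
rewrite (schur_val_restrict _ (sub0set A) (group1 _)) setD0.
rewrite (iter_down_morph (f := fun z : int => z%:~R : 'F_2)) //; last exact: intrD.
by apply: eq_iter_down => mu; rewrite /= schur_val_set0.
Qed.

Lemma irr_label_odd i X : irr_label i X ->
  ~~ (2 %| 'chi_i 1%g)%C = odd_beta N.+1 #|A| X.
Proof.
move=> [bX [b eq_i]]; rewrite /odd_beta bX /= -schur_val1 -dvdC2_int.
by rewrite -(schur_cfE GA) // eq_i cfunE dvdC2_signed.
Qed.

End Labels.

Section Restriction.
Variables (T : finType) (N k : nat) (A B : {set T}) (G H : {group {perm T}}).
Hypotheses (GA : G :=: Sym A) (HB : H :=: Sym B).
Implicit Types (nu mu : ivec N.+1).
Hypotheses (sBA : B \subset A) (card_AB : #|A :\: B| = (2 ^ k)%N).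

Local Notation vec := (bead_vec N.+1).

Lemma Sym_sub : H \subset G.
Proof.
rewrite GA HB; apply/subsetP=> g; rewrite !inE => /subset_trans; apply; exact: sBA.
Qed.

Lemma Res_schur_cf nu : 'Res[H] (schur_cf A G nu) =
  iter (2 ^ k) (down 1) (schur_cf B H) nu.
Proof.
apply/cfun_inP=> g Hg; rewrite cfResE ?Sym_sub // schur_cfE ?(subsetP Sym_sub) //.
rewrite (schur_val_restrict _ sBA) -?HB // card_AB.
rewrite (iter_down_morph (f := fun z : int => z%:~R : algC)) //; last exact: intrD.
rewrite (iter_down_morph (f := fun phi : 'CF(H) => phi g)) ?cfunE //; last by move=> x y; rewrite cfunE.
by apply: eq_iter_down => mu /=; rewrite schur_cfE.
Qed.

Lemma Res_schur_cf_dot nu mu :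
  (forall i, 0 <= mu i) -> \sum_i mu i = #|B|%:Z + 'C(N.+1, 2)%:Z ->
  '['Res[H] (schur_cf A G nu), schur_cf B H mu] =
  (iter (2 ^ k) (down 1) (fun la : ivec N.+1 => match_det la mu) nu)%:~R.
Proof.
move=> mu_ge0 sum_mu; rewrite Res_schur_cf.
rewrite (iter_down_morph (f := fun phi : 'CF(H) => '[phi, schur_cf B H mu])).
- rewrite (iter_down_morph (f := fun z : int => z%:~R : algC)) //; last exact: intrD.
  by apply: eq_iter_down => la /=; rewrite schur_cf_dot.
- exact: cfdot0l.
by move=> x y; rewrite cfdotDl.
Qed.

(** Modulo 2 the multiplicity counts the slides from [X] to [Y], and by [slide_inj] there is at most
    one. *)
Lemma odd_mult_labelP i j X Y : irr_label N A (G := G) i X -> irr_label N B (G := H) j Y ->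
  odd_mult i j <-> exists2 c, slidable (2 ^ k) X c & slide (2 ^ k) c X = Y.
Proof.
move=> [bX [b eq_i]] [bY [e eq_j]].
have szX : #|` X| = N.+1 by case/andP: bX => /eqP.
have szY : #|` Y| = N.+1 by case/andP: bY => /eqP.
have eval : (2 %| '['Res[H] 'chi_i, 'chi_j])%C =
    ((\sum_(c <- X | (2 ^ k <= c)%N && slidable (2 ^ k) X (c - 2 ^ k))
       (slide (2 ^ k) (c - 2 ^ k) X == Y))%N%:R == 0 :> 'F_2).
  have -> : '['Res[H] 'chi_i, 'chi_j] =
      (-1) ^+ b * ((-1) ^+ e * '['Res[H] (schur_cf A G (vec X)), schur_cf B H (vec Y)]).
    rewrite eq_i eq_j; case: (b); case: (e); rewrite ?expr0 ?expr1 ?scale1r ?scaleN1r;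
      by rewrite ?raddfN /= ?cfdotNl ?cfdotNr ?mul1r ?mulN1r ?opprK.
  rewrite !dvdC2_signed Res_schur_cf_dot; [|exact: bead_vec_ge0|exact: sum_bead_vec].
  rewrite dvdC2_int (iter_down_morph (f := fun z : int => z%:~R : 'F_2)) //; last exact: intrD.
  rewrite iter_down1_pow2; last exact: F2_char2.
  rewrite fermionic_bead_vec ?expn_gt0 //; last exact/fermionic_match_det/bead_vec_ge0.
  rewrite natr_sum; congr (_ == 0); apply: eq_bigr => c /andP[_ sl] /=.
  by rewrite match_det_bead_vec ?slide_size.
rewrite /odd_mult eval; split=> [nz|[c sl eqY]].
  have [/hasP[c _ /and3P[_ sl /eqP eqY]]|/hasPn none] := boolP (has (fun c =>
    [&& (2 ^ k <= c)%N, slidable (2 ^ k) X (c - 2 ^ k) & slide (2 ^ k) (c - 2 ^ k) X == Y]) X).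
    by exists (c - 2 ^ k)%N.
  case/eqP: nz; rewrite big_seq_cond big1 // => c /and3P[cX le_c sl].
  by have := none c cX; rewrite le_c sl /= => /negPf->.
have /andP[cqX _] := sl.
rewrite big_mkcond (bigD1_seq (c + 2 ^ k)%N) ?fset_uniq //= leq_addl addnK sl eqY eqxx big1 //.
move=> d neq_d; case: ifP => // /andP[le_d sld]; case: eqP => // eqY'.
case/eqP: neq_d; rewrite -(subnK le_d); congr (_ + _)%N.
by apply: (slide_inj sld sl); rewrite eqY'.
Qed.

End Restriction.

Lemma surjective_odd_restrP n k : (1 <= n)%N -> (2 ^ k < n)%N ->
  surjective (@odd_restr n k) <-> slide_onto n n k.
Proof.
case: n => // N _ lt_q; set n := N.+1 in lt_q *; set m := (n - 2 ^ k)%N.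
pose A := [set: 'I_n]; pose B := [set i : 'I_n | (i < m)%N].
pose G := [set: 'S_n]%G; pose H := Sym_below n m.
have GA : G :=: Sym A by apply/setP=> g; rewrite !inE; apply/esym/subsetP=> x; rewrite inE.
have HB : H :=: Sym B by [].
have cA : #|A| = n by rewrite cardsT card_ord.
have le_mn : (m <= n)%N by apply: leq_subr.
have cB : #|B| = m.
  rewrite cardsE -sum1_card -(big_ord_widen n (fun=> 1%N)) // sum1_card card_ord //.
have sBA : B \subset A by apply: subsetT.
have cAB : #|A :\: B| = (2 ^ k)%N.
  by rewrite cardsD (setIidPr sBA) cA cB subKn // ltnW.
have le_A : (#|A| <= n)%N by rewrite cA.
have le_B : (#|B| <= n)%N by rewrite cB.
have nE : (m + 2 ^ k)%N = n by rewrite subnK // ltnW.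
have oddG (i : odd_Iirr G) X : irr_label N A (val i) X -> odd_beta n n X.
  by move=> lab; rewrite -[X in odd_beta _ X _]cA -(irr_label_odd GA lab); apply: (valP i).
have oddH (j : odd_Iirr H) Y : irr_label N B (val j) Y -> odd_beta n m Y.
  by move=> lab; rewrite -cB -(irr_label_odd HB lab); apply: (valP j).
have restrP (i : odd_Iirr G) X Y : irr_label N A (val i) X ->
    irr_label N B (val (odd_restr k i)) Y ->
    exists2 c, slidable (2 ^ k) X c & slide (2 ^ k) c X = Y.
  move=> labX labY; apply/(odd_mult_labelP GA HB sBA cAB labX labY).
  exact: (xchooseP (odd_mult_exists (subsetT (Sym_below n (n - 2 ^ k))) i)).
split=> [surj Y oY|onto j].
  have bY : beta_set n #|B| Y by rewrite cB odd_beta_beta_set.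
  have [j labY] := irr_label_exists HB bY.
  have odd_j : ~~ (2 %| 'chi_j 1%g)%C by rewrite (irr_label_odd HB labY) cB.
  have [i eq_ij] := surj (exist _ j odd_j).
  have [X labX] := label_exists GA le_A (val i).
  have [|c sl eqY] := restrP i X Y labX; first by rewrite eq_ij.
  by exists X, c; split=> //; apply: (oddG i).
have [Y labY] := label_exists HB le_B (val j).
have oY := oddH j Y labY.
have [X [c [oX sl eqY]]] := onto Y oY.
have bX : beta_set n #|A| X by rewrite cA odd_beta_beta_set.
have [i labX] := irr_label_exists GA bX.
have odd_i : ~~ (2 %| 'chi_i 1%g)%C by rewrite (irr_label_odd GA labX) cA.
pose i' : odd_Iirr G := exist _ i odd_i; exists i'.
have [Y' labY'] := label_exists HB le_B (val (odd_restr k i')).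
have [c' sl' eqY'] := restrP i' X Y' labX labY'.
have oY' := oddH _ Y' labY'.
(* Both the prescribed slide and the one underlying the constituent chosen by [odd_restr] have odd
   remainder, so uniqueness identifies them. *)
have eq_c : c = c'.
  by apply: (@odd_slide_unique n m k X) => //; rewrite ?nE ?eqY ?eqY'.
apply/val_inj/(irr_label_inj labY'); by rewrite -eqY' -eq_c eqY.
Qed.

Theorem theorem1 (n k : nat) (n_ge1 : (1 <= n)%N) (lt_2k_n : (2 ^ k < n)%N) :
  (k = 0%N -> (surjective (@odd_restr n k) <-> (d2 n k <= 2)%N)) /\
  ((0 < k)%N -> (surjective (@odd_restr n k) <-> (d2 n k <= 1)%N)).
Proof.
have main := surjective_odd_restrP n_ge1 lt_2k_n.
have onto := slide_ontoP (ltnW lt_2k_n) (leqnn n).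
split=> [k0|k_gt0]; rewrite main onto.
  by rewrite k0.
by rewrite (gtn_eqF k_gt0).
Qed.
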